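(* Let $G$ be a non-compact locally compact group with compact covering number $\eta$ and let $\omega$ be a weight on $G$ that is diagonally bounded. Then the weighted group algebra $L^1(G,\omega)$ has an $F\ell^1(\eta)$-base of type 2.
   Context: The compact covering number of $G$ is the least cardinality of a covering of $G$ by compact sets. A weight on $G$ is a continuous function $\omega:G\to(0,\infty)$ with $\omega(st)\le\omega(s)\omega(t)$ for all $s,t$ and $\omega(e)=1$; it is diagonally bounded if for some $K>0$, $\omega(s)\omega(t)\le K\omega(st)$ for all $s,t\in G$. $L^1(G,\omega)$ is the convolution algebra of Borel measurable functions $a$ with $\omega a\in L^1(G)$ and norm $\|\omega a\|_1$; it has a bounded approximate identity. For a Banach algebra $A$, $M_r(A)$ is the algebra of bounded operators $R$ on $A$ with $R(ab)=aR(b)$, with product $R_1R_2=R_2\circ R_1$; for $a\in A$, $R\in M_r(A)$ one writes $aR=R(a)\in A$. For $A=L^1(G,\omega)$, $M_r(A)=M(G,\omega)$ (the weighted measure algebra), acting by right convolution. $\langle E\rangle$ denotes linear span; cardinals are identified with initial ordinals. $F\ell^1(\eta)$-base of type 2 in a Banach algebra $A$ with a bounded approximate identity: a set $\mathscr L=\bigcup_{\alpha<\eta}A_\alpha a_\alpha$ such that (i) $\{A_\alpha\}_{\alpha<\eta}$ is an increasing family of subsets of $A$ with $A_\eta=\bigcup_{\alpha<\eta}A_\alpha$ bounded (by $1$, say) and with closed linear span equal to $A$; (ii) $\{a_\alpha:\alpha<\eta\}$ is a bounded subset of $M_r(A)$; (iii) the spans $\langle A_\alpha a_\alpha\rangle$,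 $\alpha<\eta$, have zero pairwise intersections; (iv) for some $K_1>0$, $\sum_{n=1}^p\|x_n\|\le K_1\|\sum_{n=1}^px_n\|$ whenever $p\in\mathbb N$, $x_n\in\langle A_{\alpha_n}a_{\alpha_n}\rangle$ and $\alpha_1,\dots,\alpha_p<\eta$ are distinct; (v) for some $K_2>0$, $\|a\|\le K_2\|aa_\alpha\|$ for every $a\in\langle A_\alpha\rangle$ and $\alpha<\eta$. *)

(* Defs.v *)
From HB Require Import structures.
From mathcomp Require Import all_boot all_order all_algebra generic_quotient.
From mathcomp Require Import all_classical all_reals all_analysis.
From mathcomp Require Import measurable_realfun.
From mathcomp.real_closed Require Import complex.

Set Implicit Arguments.
Unset Strict Implicit.
Unset Printing Implicit Defensive.
Import Order.TTheory GRing.Theory Num.Theory.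
Import numFieldNormedType.Exports.

Local Open Scope classical_set_scope.
Local Open Scope ring_scope.

HB.mixin Record isTopologicalGroup G of Group G & PointedTopological G := {
  mulg_continuous : continuous (fun x : G * G => (x.1 * x.2)%g);
  invg_continuous : continuous (fun x : G => (x^-1)%g)
}.

(* The base point is required by the measurable types of the library; it is
   arbitrary and plays no role. *)
#[short(type="topologicalGroupType")]
HB.structure Definition TopologicalGroup :=
  {G of Group G & PointedTopological G & isTopologicalGroup G}.

Definition locally_compact_group (G : topologicalGroupType) : Prop :=
  hausdorff_space G /\ locally_compact [set: G].

Notation borel G := (g_sigma_algebraType (@open G)).

Record left_haar (R : realType) (G : topologicalGroupType)
    (mu : {measure set (borel G) -> \bar R}) : Prop := LeftHaar {
  haar_neq0 : mu setT <> 0%E;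
  haar_invariant : forall (x : G) (A : set (borel G)), measurable A ->
    mu [set (x * y)%g | y in (A : set G)] = mu A;
  haar_compact : forall K : set G, compact K -> (mu K < +oo)%E;
  haar_outer : forall A : set (borel G), measurable A ->
    mu A = ereal_inf [set mu U | U in [set U : set G | open U /\ A `<=` U]];
  haar_inner : forall U : set G, open U ->
    mu U = ereal_sup [set mu K | K in [set K : set G | compact K /\ K `<=` U]]
}.

Record weight (R : realType) (G : topologicalGroupType) := Weight {
  weight_fun :> G -> R;
  weight_continuous : continuous weight_fun;
  weight_gt0 : forall s, 0 < weight_fun s;
  weight_submul : forall s t,
    weight_fun (s * t)%g <= weight_fun s * weight_fun t;
  weight1 : weight_fun 1%g = 1
}.

Definition diagonally_bounded (R : realType) (G : topologicalGroupType)
    (w : weight R G) : Prop :=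
  exists2 K : R, 0 < K & forall s t, w s * w t <= K * w (s * t)%g.

Section compact_covering.
Local Open Scope card_scope.

Definition compact_covering (G : topologicalType) (F : set (set G)) : Prop :=
  (forall K, F K -> compact K) /\ \bigcup_(K in F) K = setT.

(* The cardinality of I is the least cardinality of a compact covering of G. *)
Definition compact_covering_number (G : topologicalType) (I : Type) : Prop :=
  (exists2 F : set (set G), compact_covering F & F #= [set: I]) /\
  (forall F : set (set G), compact_covering F -> [set: I] #<= F).

(* I is order-isomorphic to a cardinal, i.e. to the set of ordinals alpha < eta
   where the ordinal eta is initial. *)
Definition initial_ordinal (d : Order.disp_t) (I : orderType d) : Prop :=
  well_founded (fun x y : I => (x < y)%O) /\
  forall i : I, ~ ([set: I] #<= [set j : I | (j < i)%O]).

End compact_covering.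

Section normed_algebra.
Variables (K : numFieldType) (A : normedModType K) (mul : A -> A -> A).

Definition lin_span (E : set A) : set A :=
  [set x | exists (n : nat) (c : 'I_n -> K) (v : 'I_n -> A),
     (forall i, E (v i)) /\ x = \sum_(i < n) c i *: v i].

(* T belongs to M_r(A); for a in A, the element a T of A is T a. *)
Definition right_multiplier (T : A -> A) : Prop :=
  [/\ linear T,
      (exists M : K, forall a, `|T a| <= M * `|a|) &
      (forall a b, T (mul a b) = mul a (T b))].

(* A with the product mul is meant to be a Banach algebra with a bounded
   approximate identity; the clauses below only involve its operations. The
   ordinals alpha < eta are the elements of I, and T i is the multiplier a_i. *)
Definition Fl1_base_type2 (d : Order.disp_t) (I : orderType d) (L : set A)
    : Prop :=
  exists (As : I -> set A) (T : I -> A -> A),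
    let span i := lin_span (T i @` As i) in
  [/\ L = \bigcup_i (T i @` As i),
      [/\ (forall i j : I, (i <= j)%O -> As i `<=` As j),
          (forall a, (\bigcup_i As i) a -> `|a| <= 1) &
          closure (lin_span (\bigcup_i As i)) = setT],
      (forall i, right_multiplier (T i)) /\
      (exists M : K, forall i a, `|T i a| <= M * `|a|),
      (forall i j : I, i <> j -> span i `&` span j = [set 0]) &
      (exists2 K1 : K, 0 < K1 &
         forall (p : nat) (al : 'I_p -> I) (x : 'I_p -> A),
           injective al -> (forall n, span (al n) (x n)) ->
           \sum_(n < p) `|x n| <= K1 * `|\sum_(n < p) x n|) /\
      (exists2 K2 : K, 0 < K2 &
         forall (i : I) (a : A), lin_span (As i) a -> `|a| <= K2 * `|T i a|)].

End normed_algebra.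

Notation cnorm := ComplexField.Normc.normc.

Section weighted_L1.
Variables (R : realType) (G : topologicalGroupType).
Variables (mu : {measure set (borel G) -> \bar R}) (w : weight R G).

Definition cmeasurable (f : G -> R[i]) : Prop :=
  measurable_fun setT (@complex.Re R \o f : borel G -> R) /\
  measurable_fun setT (@complex.Im R \o f : borel G -> R).

Definition wintegrand (f : G -> R[i]) : borel G -> \bar R :=
  fun t => (w t * cnorm (f t))%:E.

(* wnorm f = || w f ||_1 *)
Definition wnorm (f : G -> R[i]) : \bar R := (\int[mu]_t wintegrand f t)%E.

Definition wL1 : {pred G -> R[i]} :=
  [pred f | `[< cmeasurable f /\ (wnorm f < +oo)%E >] ].

Lemma wL1P f : reflect (cmeasurable f /\ (wnorm f < +oo)%E) (f \in wL1).
Proof. exact: asboolP. Qed.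

Lemma cmeasurable0 : cmeasurable 0.
Proof. by split; exact: measurable_cst. Qed.

Lemma cmeasurableD f g : cmeasurable f -> cmeasurable g -> cmeasurable (f + g).
Proof.
move=> [fr fi] [gr gi]; split.
  rewrite (_ : _ \o _ = (@complex.Re R \o f) \+ (@complex.Re R \o g)).
    exact: measurable_funD.
  by apply/funext => t /=; rewrite /GRing.add/=; case: (f t) (g t) => ? ? [].
rewrite (_ : _ \o _ = (@complex.Im R \o f) \+ (@complex.Im R \o g)).
  exact: measurable_funD.
by apply/funext => t /=; rewrite /GRing.add/=; case: (f t) (g t) => ? ? [].
Qed.

Lemma cmeasurableZ (c : R[i]) f : cmeasurable f -> cmeasurable (c *: f).
Proof.
case: c => a b [fr fi]; split.
  rewrite (_ : _ \o _ = (cst a \* (@complex.Re R \o f)) \-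
      (cst b \* (@complex.Im R \o f))).
    by apply: measurable_funB; apply: measurable_funM => //; exact: measurable_cst.
  by apply/funext => t /=; rewrite /GRing.scale/=; case: (f t).
rewrite (_ : _ \o _ = (cst a \* (@complex.Im R \o f)) \+
    (cst b \* (@complex.Re R \o f))).
  by apply: measurable_funD; apply: measurable_funM => //; exact: measurable_cst.
by apply/funext => t /=; rewrite /GRing.scale/=; case: (f t).
Qed.

Lemma cnorm_ge0 (z : R[i]) : 0 <= cnorm z.
Proof. by case: z => a b; exact: sqrtr_ge0. Qed.

Lemma wintegrand_ge0 f t : (0 <= wintegrand f t)%E.
Proof. by rewrite lee_fin mulr_ge0 ?cnorm_ge0// ltW ?weight_gt0. Qed.

Lemma measurable_weight : measurable_fun setT (w : borel G -> R).
Proof.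
apply: (measurability _ (RGenOpens.measurableE R)) => _ [_ [a [b ->] <-]].
rewrite setTI; apply: sub_sigma_algebra.
by move/continuousP: (@weight_continuous _ _ w); apply; exact: interval_open.
Qed.

Lemma measurable_wintegrand f : cmeasurable f ->
  measurable_fun setT (wintegrand f).
Proof.
move=> [fr fi]; apply/measurable_EFinP.
apply: measurable_funM; first exact: measurable_weight.
rewrite (_ : (fun t => _) = @Num.sqrt R \o
    ((fun t => (@complex.Re R \o f) t ^+ 2) \+ (fun t => (@complex.Im R \o f) t ^+ 2))).
  apply: measurableT_comp.
    by apply: continuous_measurable_fun; exact: sqrt_continuous.
  by apply: measurable_funD; exact: measurable_funX.
by apply/funext => t /=; case: (f t).
Qed.

Lemma wnorm_ge0 f : (0 <= wnorm f)%E.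
Proof. by apply: integral_ge0 => t _; exact: wintegrand_ge0. Qed.

Lemma wnormD f g : cmeasurable f -> cmeasurable g ->
  (wnorm (f + g)%R <= wnorm f + wnorm g)%E.
Proof.
move=> mf mg; rewrite /wnorm -ge0_integralD//; first last.
- exact: measurable_wintegrand.
- by move=> t _; exact: wintegrand_ge0.
- exact: measurable_wintegrand.
- by move=> t _; exact: wintegrand_ge0.
apply: ge0_le_integral => //.
- by move=> t _; exact: wintegrand_ge0.
- by apply: measurable_wintegrand; exact: cmeasurableD.
- by apply: emeasurable_funD; exact: measurable_wintegrand.
move=> t _; rewrite -EFinD lee_fin -mulrDr ler_pM2l ?weight_gt0//.
exact: complex.le_normcD.
Qed.

Lemma wnormZ (c : R[i]) f : cmeasurable f ->
  wnorm (c *: f) = ((cnorm c)%:E * wnorm f)%E.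
Proof.
move=> mf; rewrite /wnorm -ge0_integralZl_EFin ?cnorm_ge0//; first last.
- exact: measurable_wintegrand.
- by move=> t _; exact: wintegrand_ge0.
apply: eq_integral => t _; rewrite /wintegrand -EFinM; congr _%:E.
by rewrite [cnorm _](ComplexField.Normc.normcM c (f t)) mulrCA.
Qed.

Lemma wnorm0 : wnorm 0 = 0%E.
Proof.
by rewrite -(scale0r 0) wnormZ; [rewrite ComplexField.Normc.normc0 mul0e|exact: cmeasurable0].
Qed.

Lemma wL1_submod_closed : submod_closed wL1.
Proof.
split; first by apply/wL1P; rewrite wnorm0; split; [exact: cmeasurable0|].
move=> c f g /wL1P[mf nf] /wL1P[mg ng]; apply/wL1P.
have mcf := cmeasurableZ c mf; split; first exact: cmeasurableD.
apply: (le_lt_trans (wnormD mcf mg)); rewrite lte_add_pinfty// wnormZ//.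
by rewrite lte_mul_pinfty// lee_fin cnorm_ge0.
Qed.

HB.instance Definition _ :=
  GRing.isSubmodClosed.Build R[i] (G -> R[i]) wL1 wL1_submod_closed.

Record L1fun := L1Fun { L1fun_val :> G -> R[i]; L1funP : L1fun_val \in wL1 }.

HB.instance Definition _ := [isSub for L1fun_val].
HB.instance Definition _ := [Choice of L1fun by <:].
HB.instance Definition _ := [SubChoice_isSubLmodule of L1fun by <:].

Lemma L1fun_valN (f : L1fun) t : (- f : L1fun) t = - f t.
Proof. by []. Qed.

Lemma L1fun_valD (f g : L1fun) t : (f + g : L1fun) t = f t + g t.
Proof. by []. Qed.

Lemma L1fun_valZ (c : R[i]) (f : L1fun) t : (c *: f : L1fun) t = c * f t.
Proof. reflexivity. Qed.

Definition L1eq (f g : L1fun) : bool :=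
  `[< \forall t \ae mu, (f : G -> R[i]) t = g t >].

Lemma L1eqP (f g : L1fun) :
  reflect (\forall t \ae mu, (f : G -> R[i]) t = g t) (L1eq f g).
Proof. exact: asboolP. Qed.

#[local] Instance ae_borel_filter : Filter (nbhs (almost_everywhere mu)).
Proof. exact: (ae_filter_ringOfSetsType mu). Qed.

Lemma L1eq_refl : reflexive L1eq.
Proof. by move=> f; apply/L1eqP/aeW. Qed.

Lemma L1eq_sym : symmetric L1eq.
Proof.
by move=> f g; apply/L1eqP/L1eqP; apply: filterS => t ->.
Qed.

Lemma L1eq_trans : transitive L1eq.
Proof.
move=> g f h /L1eqP fg /L1eqP gh; apply/L1eqP.
by move: fg gh; apply: filterS2 => t -> ->.
Qed.

Canonical L1eq_equiv := EquivRel L1eq L1eq_refl L1eq_sym L1eq_trans.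

Local Open Scope quotient_scope.

Definition L1 : Type := {eq_quot L1eq}.
HB.instance Definition _ := Choice.on L1.
HB.instance Definition _ := EqQuotient.on L1.

Local Open Scope quotient_scope.

Lemma L1_pi_eq (f g : L1fun) :
  (\forall t \ae mu, (f : G -> R[i]) t = g t) <-> \pi_L1 f = \pi_L1 g.
Proof. by split=> [fg|/eqquotP/L1eqP//]; apply/eqquotP/L1eqP. Qed.

Lemma L1_repr (f : L1fun) :
  \forall t \ae mu, (repr (\pi_L1 f) : G -> R[i]) t = f t.
Proof. by apply/L1_pi_eq; rewrite reprK. Qed.

Definition L1_zero : L1 := \pi_L1 (0 : L1fun).
Definition L1_opp (a : L1) : L1 := \pi_L1 (- repr a : L1fun).
Definition L1_add (a b : L1) : L1 := \pi_L1 (repr a + repr b : L1fun).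
Definition L1_scale (c : R[i]) (a : L1) : L1 := \pi_L1 (c *: repr a : L1fun).

Lemma L1_piN (f : L1fun) : \pi_L1 (- f : L1fun) = L1_opp (\pi f).
Proof.
by apply/L1_pi_eq; have := L1_repr f; apply: filterS => t; rewrite !L1fun_valN => ->.
Qed.

Lemma L1_piD (f g : L1fun) : \pi_L1 (f + g : L1fun) = L1_add (\pi f) (\pi g).
Proof.
apply/L1_pi_eq; have := L1_repr g; have := L1_repr f.
by apply: filterS2 => t; rewrite !L1fun_valD => -> ->.
Qed.

Lemma L1_piZ (c : R[i]) (f : L1fun) : \pi_L1 (c *: f : L1fun) = L1_scale c (\pi f).
Proof.
by apply/L1_pi_eq; have := L1_repr f; apply: filterS => t; rewrite !L1fun_valZ => ->.
Qed.

Lemma L1_addA : associative L1_add.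
Proof. by elim/quotW=> f; elim/quotW=> g; elim/quotW=> h; rewrite -!L1_piD addrA. Qed.

Lemma L1_addC : commutative L1_add.
Proof. by elim/quotW=> f; elim/quotW=> g; rewrite -!L1_piD addrC. Qed.

Lemma L1_add0 : left_id L1_zero L1_add.
Proof. by elim/quotW=> f; rewrite -L1_piD add0r. Qed.

Lemma L1_addN : left_inverse L1_zero L1_opp L1_add.
Proof. by elim/quotW=> f; rewrite -L1_piN -L1_piD addNr. Qed.

HB.instance Definition _ :=
  GRing.isZmodule.Build L1 L1_addA L1_addC L1_add0 L1_addN.

Lemma L1_scaleA c d (a : L1) : L1_scale c (L1_scale d a) = L1_scale (c * d) a.
Proof. by elim/quotW: a => f; rewrite -!L1_piZ scalerA. Qed.

Lemma L1_scale1 : left_id 1 L1_scale.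
Proof. by elim/quotW=> f; rewrite -L1_piZ scale1r. Qed.

Lemma L1_scaleDr : right_distributive L1_scale L1_add.
Proof.
by move=> c; elim/quotW=> f; elim/quotW=> g; rewrite -!(L1_piZ, L1_piD) scalerDr.
Qed.

Lemma L1_scaleDl (a : L1) : {morph L1_scale^~ a : c d / c + d >-> c + d}.
Proof.
by elim/quotW: a => f c d; rewrite -!L1_piZ -[RHS]L1_piD scalerDl.
Qed.

HB.instance Definition _ := GRing.Zmodule_isLmodule.Build R[i] L1
  L1_scaleA L1_scale1 L1_scaleDr L1_scaleDl.

Definition L1_norm (a : L1) : R[i] := (fine (wnorm (repr a)))%:C%C.

Lemma L1fun_wnorm (f : L1fun) : wnorm f \is a fin_num.
Proof. by rewrite ge0_fin_numE ?wnorm_ge0//; have /wL1P[] := L1funP f. Qed.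

Lemma L1_norm_pi f : L1_norm (\pi f) = (fine (wnorm f))%:C%C.
Proof.
rewrite /L1_norm; congr (fine _)%:C%C.
have /wL1P[mf _] := L1funP f; have /wL1P[mg _] := L1funP (repr (\pi_L1 f)).
apply: ge0_ae_eq_integral => //.
- exact: measurable_wintegrand.
- exact: measurable_wintegrand.
- by move=> t _; exact: wintegrand_ge0.
- by move=> t _; exact: wintegrand_ge0.
by have := L1_repr f; apply: filterS => t ft _; rewrite /wintegrand ft.
Qed.

Lemma L1_ler_normD (a b : L1) : L1_norm (a + b) <= L1_norm a + L1_norm b.
Proof.
elim/quotW: a => f; elim/quotW: b => g; rewrite -[_ + _]L1_piD !L1_norm_pi.
rewrite -rmorphD lecR -fineD ?L1fun_wnorm//.
have /wL1P[mf _] := L1funP f; have /wL1P[mg _] := L1funP g.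
apply: fine_le; first exact: L1fun_wnorm.
  by rewrite fin_numD; apply/andP; split; exact: L1fun_wnorm.
exact: (wnormD mf mg).
Qed.

Lemma L1_normrZ (c : R[i]) (a : L1) : L1_norm (c *: a) = `|c| * L1_norm a.
Proof.
elim/quotW: a => f; rewrite -[_ *: _]L1_piZ !L1_norm_pi.
have /wL1P[mf _] := L1funP f.
by rewrite [wnorm _](wnormZ c mf) fineM ?L1fun_wnorm// rmorphM.
Qed.

Lemma L1_normr0_eq0 (a : L1) : L1_norm a = 0 -> a = 0.
Proof.
elim/quotW: a => f; rewrite L1_norm_pi => -[nf0].
have /wL1P[mf _] := L1funP f.
have {}nf0 : wnorm f = 0%E by rewrite -[LHS]fineK ?L1fun_wnorm// nf0.
have mw := measurable_wintegrand mf.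
apply/L1_pi_eq.
have /(ae_eq_integral_abs mu measurableT mw) : 
    (\int[mu]_t `|wintegrand f t| = 0)%E.
  by rewrite -[RHS]nf0; apply: eq_integral => t _; rewrite gee0_abs ?wintegrand_ge0.
apply: filterS => t /(_ I)/eqP; rewrite eqe mulf_eq0 gt_eqF ?weight_gt0//=.
by move=> /eqP/ComplexField.Normc.eq0_normc.
Qed.

HB.instance Definition _ :=
  Lmodule_isNormed.Build R[i] L1 L1_ler_normD L1_normrZ L1_normr0_eq0.

End weighted_L1.

(* The integral is taken componentwise; where the integrand is not integrable,
   which happens on a null set of t only when f and g are in L^1(G, w), the
   convention of the library gives an irrelevant finite value. *)
Definition convolution (R : realType) (G : topologicalGroupType)
    (mu : {measure set (borel G) -> \bar R}) (f g : G -> R[i]) (t : G) : R[i] :=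
  Complex (\int[mu]_s complex.Re (f s * g (s^-1 * t)%g))
          (\int[mu]_s complex.Im (f s * g (s^-1 * t)%g)).

(* For a left Haar measure mu, the convolution of f and g is again in L^1(G, w)
   and its class depends only on the classes of f and g, so that the default
   value 0 of insubd is never taken and the choice of repr is immaterial. *)
Definition L1_mul (R : realType) (G : topologicalGroupType)
    (mu : {measure set (borel G) -> \bar R}) (w : weight R G) (a b : L1 mu w) :
    L1 mu w :=
  \pi_(L1 mu w)%qT (insubd (0 : L1fun mu w) (convolution mu (repr a) (repr b))).

(* Main.v *)
Require Import Defs.
From HB Require Import structures.
From mathcomp Require Import all_boot all_order all_algebra generic_quotient.
From mathcomp Require Import all_classical all_reals all_analysis.
From mathcomp Require Import measurable_realfun lra.
From mathcomp.real_closed Require Import complex.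

(* Right translation by t, divided by Delta(t) w(t), is a right multiplier of
   L^1(G, w) of norm at most 1, and it is bounded below because w is diagonally
   bounded. Cover G by the interiors of eta compact sets K_i, let A_i be the set
   of the elements of the unit ball supported in some K_g with g <= i, and pick
   t_i by transfinite recursion outside all the sets K_g^-1 K_h t_j with g <= i
   and h <= j < i. By Hessenberg's theorem there are fewer than eta of these, so
   they do not cover G. The supports of the elements of the various A_i t_i are
   then pairwise disjoint, and their norms add up.

   The modular function Delta comes from a proof of the uniqueness of the Haar
   measure that avoids Urysohn's lemma and the Borel sets of G x G. The functions
   z |-> mu (A n zB) with B open of finite measure are left uniformly continuous
   and supply bump functions; for such f and g the function f(x) g(y^-1 x) is
   measurable for the product sigma-algebra, and Fubini's theorem gives
     int f(x) dx . int g(y^-1) dy = int g(z) (int f(yz) dy) dz.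
   Hence int f(yz) dy / int f(y) dy does not depend on f. The same identity shows
   that inversion preserves null sets, so that the convolution of two classes is
   defined pointwise and commutes with right translations pointwise. *)

Set Implicit Arguments.
Unset Strict Implicit.
Unset Printing Implicit Defensive.
Import Order.TTheory GRing.Theory Num.Theory.
Import numFieldNormedType.Exports.

Local Open Scope classical_set_scope.
Local Open Scope ring_scope.

(** * Cardinals and transfinite recursion *)

Section cardinals.
Local Open Scope card_scope.

(** The library's injection lives on the subtype of [A]; extending it by the default [u0] gives an
    ordinary function that can be paired and composed. *)
Lemma card_le_set_fun T U (A : set T) (B : set U) (u0 : U) : A #<= B ->
  exists2 f : T -> U, set_fun A B f & set_inj A f.
Proof.
move=> /card_leP[f].
exists (fun x => if pselect (A x) is left Ax
  then val (f (SigSub (mem_set Ax))) else u0) => [x Ax|x y /set_mem Ax /set_mem Ay].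
  by case: pselect => // A'x; exact: set_valP.
case: pselect => // A'x; case: pselect => // A'y /val_inj fxy.
have : SigSub (mem_set A'x) = SigSub (mem_set A'y) :> set_type A.
  by apply: (inj _ _ fxy); rewrite inE.
by case.
Qed.

Lemma set_fun_card_le T U (A : set T) (B : set U) (f : T -> U) :
  set_fun A B f -> set_inj A f -> A #<= B.
Proof.
move=> fAB finj; have : $|{injfun A >-> B}| by apply/injfunPex; exists f.
by case=> g; exact: inj_card_le.
Qed.

Lemma card_le_setX T U T' U' (A : set T) (B : set U) (A' : set T') (B' : set U') :
  A #<= B -> A' #<= B' -> A `*` A' #<= B `*` B'.
Proof.
have [->|/set0P[[a a'] [Aa A'a]]] := eqVneq (A `*` A') set0; first by move=> *;
  exact: card_ge0.
move=> lAB lAB'.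
have [b Bb] : exists b, B b.
  by case/card_leP: (lAB) => f; exists (val (f (SigSub (mem_set Aa)))); exact: set_valP.
have [b' Bb'] : exists b, B' b.
  by case/card_leP: (lAB') => f; exists (val (f (SigSub (mem_set A'a))));
    exact: set_valP.
have [f fAB finj] := card_le_set_fun b lAB.
have [g gAB ginj] := card_le_set_fun b' lAB'.
apply: (@set_fun_card_le _ _ _ _ (fun x => (f x.1, g x.2))).
  by move=> [x y] [/= Ax Ay]; split; [exact: fAB|exact: gAB].
move=> [x y] [x' y'] /set_mem[/= Ax Ay] /set_mem[/= Ax' Ay'] [fx gy].
by congr pair; [apply: finj fx|apply: ginj gy]; rewrite inE.
Qed.

(** Hilbert's hotel: [x] goes to [nu 0], each [nu n] moves to [nu n.+1], and every other point
    stays. *)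
Lemma card_le_setU1 T (x : T) (A : set T) : infinite_set A -> x |` A #<= A.
Proof.
move=> /infiniteP/(card_le_set_fun x)[nu nuA nuinj].
have nuI m n : nu m = nu n -> m = n by apply: nuinj; rewrite inE.
pose f y := if pselect (y = x) then nu 0%N else
  if pselect (exists n, nu n = y) is left e then nu (projT1 (cid e)).+1 else y.
have [Ax|nAx] := pselect (A x).
  by apply: subset_card_le => y [->|].
have fx : f x = nu 0%N by rewrite /f; case: (pselect (x = x)) => /=.
have fnu n : f (nu n) = nu n.+1.
  rewrite /f; case: (pselect (nu n = x)) => [nx|_] /=.
    by case: nAx; rewrite -nx; exact: nuA.
  case: (pselect (exists m, nu m = nu n)) => [e|[]]; last by exists n.
  by case: (cid e) => m /= nm; congr nu; congr S; exact: nuI.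
have fid y : y <> x -> (forall n, nu n <> y) -> f y = y.
  move=> yx ynu; rewrite /f; case: (pselect (y = x)) => //= _.
  by case: (pselect (exists m, nu m = y)) => // e; have [m /ynu] := e.
have P y : (x |` A) y ->
    [\/ y = x, exists n, y = nu n | [/\ A y, y <> x & forall n, nu n <> y]].
  move=> yA; have [?|yx] := pselect (y = x); first by constructor 1.
  have [[n ny]|ny] := pselect (exists n, nu n = y); first by constructor 2; exists n.
  by constructor 3; split=> [||n nny]; [case: yA| |apply: ny; exists n].
apply: (@set_fun_card_le _ _ _ _ f) => [y|y z /set_mem + /set_mem].
  by move=> /P[->|[n ->]|[Ay yx ynu]]; rewrite ?fx ?fnu ?fid//; exact: nuA.
move=> /P[->|[n ->]|[Ay yx ynu]] /P[->|[m ->]|[Az zx znu]];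
  rewrite ?fx ?fnu ?(fid y)// ?(fid z)// => //.
- by move=> /nuI.
- by move=> /znu.
- by move=> /nuI.
- by move=> /nuI[->].
- by move=> /znu.
- by move=> /esym/ynu.
- by move=> /esym/ynu.
Qed.

(** Transfinite recursion with a choice at each stage. Since [P] takes total functions, the values
    found so far are extended by [y0]; the second hypothesis says that [P x] cannot see this
    extension. *)
Lemma wf_dependent_choice (X Y : Type) (r : X -> X -> Prop) (y0 : Y)
    (P : X -> (X -> Y) -> Y -> Prop) :
  well_founded r ->
  (forall x f g, (forall y, r y x -> f y = g y) -> P x f = P x g) ->
  (forall x f, exists y, P x f y) ->
  exists f : X -> Y, forall x, P x f (f x).
Proof.
move=> wfr extP exP.
pose ext x (f : forall y, r y x -> Y) y :=
  if pselect (r y x) is left ryx then f y ryx else y0.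
pose F x f := projT1 (cid (exP x (@ext x f))).
exists (Fix wfr (fun=> Y) F) => x.
rewrite Fix_eq; last first.
  by move=> z f g fg; congr F; apply/functional_extensionality_dep => y;
    apply/functional_extensionality_dep => ryz; exact: fg.
rewrite /F; case: (cid _) => y /=; rewrite (extP x _ (Fix wfr (fun=> Y) F))//.
by move=> z rzx; rewrite /ext; case: pselect.
Qed.

(** Each [x] in [A] is sent to a point of [S] missed by its predecessors; one is left because [S]
    does not embed into the segment of [A] below [x]. *)
Lemma wf_card_le (X Y : Type) (r : X -> X -> Prop) (A : set X) (S : set Y) :
  well_founded r -> (forall x y, r x y \/ x = y \/ r y x) ->
  (forall x, A x -> ~ (S #<= A `&` r^~ x)) -> A #<= S.
Proof.
move=> wfr totr nS; have [->|/set0P[x0 Ax0]] := eqVneq A set0; first exact: card_ge0.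
have [y0 Sy0] : S !=set0.
  by apply/set0P/negP => /eqP S0; apply: (nS _ Ax0); rewrite S0 card_ge0.
pose P x f y := A x -> S y /\ ~ (f @` (A `&` r^~ x)) y.
have [x f g fg|x f|f fP] := @wf_dependent_choice X Y r y0 P wfr.
- apply/funext => y; rewrite /P;
  suff -> : f @` (A `&` r^~ x) = g @` (A `&` r^~ x) by [].
  by apply/seteqP; split=> _ [z [Az rzx] <-]; exists z => //; rewrite fg.
- have [Ax|nAx] := pselect (A x); last by exists y0.
  suff [y [Sy ny]] : S `\` f @` (A `&` r^~ x) !=set0 by exists y.
  apply/set0P/negP => /eqP; rewrite setD_eq0 => SP; apply: (nS _ Ax).
  exact: (card_le_trans (subset_card_le SP) (card_image_le _ _)).
apply: (@set_fun_card_le _ _ _ _ f) => [x Ax|x y /set_mem Ax /set_mem Ay fxy].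
  by have [] := fP x Ax.
have [rxy|[//|ryx]] := totr x y.
  by case: (fP y Ay) => _ []; exists x.
by case: (fP x Ax) => _ []; exists y.
Qed.

Section square.
Variables (d : Order.disp_t) (I : orderType d).
Hypothesis wfI : well_founded (fun x y : I => (x < y)%O).

Let goedel (p q : I * I) := let m (p : I * I) := Order.max p.1 p.2 in
  (m p < m q)%O \/ m p = m q /\ ((p.1 < q.1)%O \/ p.1 = q.1 /\ (p.2 < q.2)%O).

Let wf_goedel : well_founded goedel.
Proof.
suff H m a b : Order.max a b = m -> Acc goedel (a, b) by case=> a b; exact: H.
elim/(well_founded_ind wfI): m a b => m IHm a.
elim/(well_founded_ind wfI): a => a IHa b.
elim/(well_founded_ind wfI): b => b IHb abm.
constructor=> -[a' b'] [/=|[/= a'b' [a'a|[a'a b'b]]]].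
- by rewrite abm => /IHm; apply.
- by apply: IHa => //; rewrite a'b'.
- by subst a'; apply: IHb => //; rewrite a'b'.
Qed.

Let goedel_total p q : goedel p q \/ p = q \/ goedel q p.
Proof.
rewrite /goedel; case: p q => [a b] [a' b'] /=.
case: (ltgtP (Order.max a b) (Order.max a' b')) => [||->]; [by left;
  left|by right; right; left|].
case: (ltgtP a a') => [||->]; [by left; right; split=> //; left|by right; right;
  right; split=> //; left|].
case: (ltgtP b b') => [||->]; [by left; right; split=> //; right|by right; right;
  right; split=> //; right|].
by right; left.
Qed.

(* Hessenberg's theorem, via the Goedel ordering of pairs: its proper initial
   segments lie in squares of smaller segments. *)
Lemma card_segment_square (i : I) : infinite_set [set j | (j < i)%O] ->
  [set j | (j < i)%O] `*` [set j | (j < i)%O] #<= [set j | (j < i)%O].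
Proof.
elim/(well_founded_ind wfI): i => i IH infi.
(* Either the segment of [i] embeds into a smaller one, and induction applies there, or [i] behaves
   like an initial ordinal. *)
have [[j ji jle]|small] := pselect (exists2 j, (j < i)%O &
    [set j | (j < i)%O] #<= [set k | (k < j)%O]).
  have infj : infinite_set [set k | (k < j)%O].
    by apply: contra_not infi; exact: card_le_finite.
  apply: card_le_trans (card_le_setX jle jle) _.
  apply: card_le_trans (IH j ji infj) _; apply: subset_card_le => k /= kj.
  exact: lt_trans kj ji.
apply: (wf_card_le wf_goedel goedel_total) => -[a b] [/= ai bi].
pose m := Order.max a b; have mi : (m < i)%O by rewrite /m gt_max ai bi.
have sub : ([set j | (j < i)%O] `*` [set j | (j < i)%O]) `&` goedel^~ (a, b) `<=`
    (m |` [set k | (k < m)%O]) `*` (m |` [set k | (k < m)%O]).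
  move=> [a' b'] [_ /= gab].
  have : (Order.max a' b' <= m)%O by case: gab => [/ltW//|[->]].
  rewrite ge_max => /andP[a'm b'm]; split=> /=.
  - by move: a'm; rewrite le_eqVlt => /orP[/eqP->|]; [left|right].
  - by move: b'm; rewrite le_eqVlt => /orP[/eqP->|]; [left|right].
move=> /card_le_trans/(_ (subset_card_le sub)) ile.
have [finm|infm] := pselect (finite_set [set k | (k < m)%O]).
  apply: infi; apply: card_le_finite ile _; apply: finite_setX;
  by rewrite finite_setU; split=> //; exact: finite_set1.
(* Adding [m] does not enlarge an infinite segment, so by induction the segment of [i] would embed
   into that of [m], against [small]. *)
apply: small; exists m => //; apply: card_le_trans ile _.
apply: card_le_trans (card_le_setX (card_le_setU1 m infm) (card_le_setU1 m infm)) _.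
exact: IH.
Qed.

(** The sets to avoid at stage [i] of the later recursion are indexed by such triples. An infinite
    closed segment is no larger than the open one, so Hessenberg's theorem applies twice. *)
Lemma card_segment_cube (i : I) : infinite_set [set: I] ->
  (forall i : I, ~ ([set: I] #<= [set j : I | (j < i)%O])) ->
  ~ ([set: I] #<= [set j | (j <= i)%O] `*`
       ([set j | (j <= i)%O] `*` [set j | (j <= i)%O])).
Proof.
move=> infI initI.
have -> : [set j | (j <= i)%O] = i |` [set j | (j < i)%O].
  apply/seteqP; split=> [j /=|j [->|/ltW]//=].
  by rewrite le_eqVlt => /orP[/eqP->|]; [left|right].
have [fini|infi] := pselect (finite_set [set k | (k < i)%O]).
  apply: contra_not infI => /card_le_finite; apply.
  by do 2?[apply: finite_setX]; rewrite finite_setU; split=> //; exact: finite_set1.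
have U1 := card_le_setU1 i infi; have sq := card_segment_square infi.
move=> lI; apply: (initI i); apply: card_le_trans lI _.
apply: card_le_trans (card_le_setX U1 (card_le_setX U1 U1)) _.
by apply: card_le_trans (card_le_setX (card_lexx _) sq) sq.
Qed.

End square.
End cardinals.

(** * Topological groups *)

Section topological_group.
Variable G : topologicalGroupType.
Implicit Types (x y z u : G) (A B K U V : set G).
Local Open Scope group_scope.

Lemma continuous_mulg (T : topologicalType) (f g : T -> G) :
  continuous f -> continuous g -> continuous (fun t => f t * g t).
Proof.
move=> cf cg t.
apply: (@continuous2_cvg _ _ _ _ (nbhs t) _ f g (fun a b => a * b)) => //.
- exact: (@mulg_continuous G (f t, g t)).
- exact: cf.
- exact: cg.
Qed.

Lemma continuous_invg (T : topologicalType) (f : T -> G) :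
  continuous f -> continuous (fun t => (f t)^-1).
Proof.
move=> cf t; apply: (@continuous_comp _ _ _ f (fun a => a^-1)); first exact: cf.
exact: invg_continuous.
Qed.

Lemma open_comp_continuous (T T' : topologicalType) (f : T -> T') (U : set T') :
  continuous f -> open U -> open (fun t => U (f t)).
Proof. by move=> /continuousP cf; exact: cf. Qed.

Lemma compact_image_continuous (T T' : topologicalType) (f : T -> T') (K : set T) :
  continuous f -> compact K -> compact (f @` K).
Proof. by move=> cf; apply: continuous_compact; apply: continuous_subspaceT. Qed.

Lemma compact_mulg A B : compact A -> compact B ->
  compact [set a * b | a in A & b in B].
Proof.
move=> cA cB; rewrite (_ : [set _ | _ in _ & _ in _] =
    (fun x : G * G => x.1 * x.2) @` (A `*` B)).
  by apply: compact_image_continuous (compact_setX cA cB); exact: mulg_continuous.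
apply/seteqP; split=> [_ [a Aa [b Bb <-]]|_ [[a b] [/= Aa Bb] <-]].
  by exists (a, b).
by exists a => //; exists b.
Qed.

Lemma compact_invg A : compact A -> compact [set a^-1 | a in A].
Proof. by move=> cA; apply: compact_image_continuous => //; exact: invg_continuous. Qed.

Lemma near1_inv (P : set G) : (\forall u \near 1, P u) -> \forall u \near 1, P u^-1.
Proof.
by move=> nP; apply: (@invg_continuous G 1); rewrite invg1.
Qed.

Lemma near1_mul x (P : set G) : (\forall u \near 1, P (x * u)) -> \forall y \near
  x, P y.
Proof.
move=> nP.
have := @continuous_mulg _ (fun _ : G => x^-1) id (@cst_continuous _ _ _) (fun=>
  cvg_id) x.
move=> /(_ (fun u => P (x * u))); rewrite mulVg => /(_ nP) nxP.
change (nbhs x (fun y => P (x * (x^-1 * y)))) in nxP.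
by apply: filterS nxP => y; rewrite mulVKg.
Qed.

(** A tube lemma: compactness of [K] makes one neighborhood of 1 serve all its points. The abstract
    [op] covers multiplication by [u] on either side. *)
Lemma compact_near1 (op : G -> G -> G) K U :
  continuous (fun z : G * G => op z.1 z.2) -> (forall x, op x 1 = x) ->
  compact K -> open U -> K `<=` U -> \forall u \near 1, forall x, K x -> U (op x u).
Proof.
move=> cop op1 /compact_near_coveringP cK oU KU.
have := cK G (nbhs 1) (fun u x => U (op x u)) _; apply => x Kx.
have : nbhs (op x 1) U by rewrite op1; apply: open_nbhs_nbhs; split=> //; exact: KU.
by move=> /(cop (x, 1)).
Qed.

Lemma compact_nbhs1 : locally_compact_group G ->
  exists2 V, compact V & nbhs (1 : G) V.
Proof.
move=> [_ /(_ 1 I)[V nV [cV _]]]; exists V => //.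
by move: nV; rewrite /within/=; apply: filterS => x; apply.
Qed.
End topological_group.

(** * Haar measure *)

Lemma compact_open_cover (T : ptopologicalType) (J : choiceType) (K : set T)
    (F : J -> set T) : compact K -> (forall j, open (F j)) ->
  (forall x, K x -> exists j, F j x) ->
  exists D : seq J, K `<=` \bigcup_(j in [set` D]) F j.
Proof.
rewrite compact_cover => cK oF KF.
have [|D _ KD] := cK J setT F (fun j _ => oF j); last by exists (finmap.enum_fset D).
by move=> x /KF[j Fjx]; exists j.
Qed.

(** Closeness of [z] and [z * u] is preserved by left translations, so [q (th y * x)] can be
    approximated uniformly in [y]. *)
Definition left_ucont (R : realType) (G : topologicalGroupType) (f : G -> R) :=
  forall e : R, 0 < e -> \forall u \near (1%g : G), forall z, `|f (z * u)%g - f z| <= e.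

Lemma left_ucont_continuous (R : realType) (G : topologicalGroupType) (f : G -> R) :
  left_ucont f -> continuous f.
Proof.
move=> uf x; apply/(cvgrPdist_le (FF := nbhs_filter _)) => e e0.
apply: near1_mul; have := uf e e0; apply: filterS => u /(_ x).
by rewrite distrC.
Qed.

Section haar.
Variables (R : realType) (G : topologicalGroupType).
Variable mu : {measure set (borel G) -> \bar R}.
Hypothesis lcG : locally_compact_group G.
Hypothesis haar_mu : left_haar mu.
Implicit Types (x y z u t : G) (A B K U V : set G).

Lemma borel_open U : open U -> measurable (U : set (borel G)).
Proof. by move=> oU; exact: sub_sigma_algebra. Qed.

Lemma borel_compact K : compact K -> measurable (K : set (borel G)).
Proof.
move=> cK; rewrite -(setCK K); apply: measurableC; apply: borel_open.
by apply: closed_openC; apply: compact_closed => //; case: lcG.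
Qed.

Lemma borel_continuous (f : G -> R) : continuous f ->
  measurable_fun setT (f : borel G -> R).
Proof.
move=> cf; apply: (measurability _ (RGenOpens.measurableE R)) => _ [_ [a [b ->] <-]].
rewrite setTI; apply: sub_sigma_algebra.
by move/continuousP: cf; apply; exact: interval_open.
Qed.

Lemma borel_homeo (f : G -> G) : continuous f ->
  measurable_fun setT (f : borel G -> borel G).
Proof.
move=> cf; apply: (@measurability _ _ (borel G) (borel G) setT f (@open G) erefl)
  => _ [U oU <-].
by rewrite setTI; apply: borel_open; exact: open_comp_continuous.
Qed.

Lemma open_lmul U u : open U -> open [set y | U (u * y)%g].
Proof.
move=> oU; apply: open_comp_continuous oU.
by apply: continuous_mulg; [exact: cst_continuous|move=> ?; exact: cvg_id].
Qed.

Lemma haar_preimage x A : measurable (A : set (borel G)) ->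
  mu [set y | A (x * y)%g] = mu A.
Proof.
move=> mA; rewrite -(haar_invariant haar_mu x^-1%g mA); congr (mu _).
apply/seteqP; split=> [y Axy|_ [y Ay <-]/=]; last by rewrite mulVKg.
by exists (x * y)%g => //; rewrite mulKg.
Qed.

Lemma haar_integral x (f : G -> \bar R) : measurable_fun setT (f : borel G -> \bar R) ->
  (forall y, (0 <= f y)%E) ->
  (\int[mu]_y f (x * y)%g = \int[mu]_y f y)%E.
Proof.
move=> mf f0; have mx : measurable_fun setT ((fun y => x * y)%g : borel G -> borel G).
  by apply: borel_homeo; apply: continuous_mulg; [exact: cst_continuous|move=> ?;
    exact: cvg_id].
have := @ge0_integral_pushforward _ _ _ _ _ _ mx mu setT f measurableT mf (fun y
  _ => f0 y).
rewrite preimage_setT => <-; apply: eq_measure_integral => A mA _;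
  rewrite /pushforward; exact: haar_preimage.
Qed.

(** Finitely many left translates of [U] cover a given compact set. If [U] were null, so would be
    all compact sets, and by inner regularity [G] itself. *)
Lemma haar_open_gt0 U : open U -> U !=set0 -> (0 < mu U)%E.
Proof.
move=> oU [x Ux]; rewrite lt_neqAle measure_ge0 andbT; apply/eqP => /esym U0.
apply: (haar_neq0 haar_mu); rewrite (haar_inner haar_mu openT).
apply/eqP; rewrite eq_le; apply/andP; split; last first.
  apply: ereal_sup_ubound; exists set0; last by rewrite measure0.
  by split=> //; exact: compact0.
apply: ge_ereal_sup => _ [K [cK _] <-].
pose F (y : G) := [set z | U (x * (y^-1 * z))%g].
have oF y : open (F y).
  apply: open_comp_continuous oU; do 2?apply: continuous_mulg;
    by [exact: cst_continuous|move=> ?; exact: cvg_id].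
have F0 y : mu (F y) = 0%E.
  rewrite (_ : F y = [set z | U ((x * y^-1) * z)%g]); last first.
    by apply/seteqP; split=> z; rewrite /F/= mulgA.
  by rewrite haar_preimage//; exact: borel_open.
have [D KD] := compact_open_cover cK (fun y => oF y) (fun z _ => ex_intro _ z
  (eq_ind_r (fun v => U (x * v)%g) (eq_ind_r U Ux (mulg1 x)) (mulVg z))).
rewrite (_ : mu K = 0%E)//; apply: measure_negligible; first exact: borel_compact.
apply: (@negligibleS _ (borel G) R mu _ _ KD); rewrite bigcup_seq.
elim/big_ind : _ => [|B C|y _]; [exact: negligible_set0|exact: negligibleU|].
by have [_ +] := @negligibleP _ (borel G) R mu _ (borel_open (oF y)); apply; exact: F0.
Qed.

Lemma haar_inner_approx U (e : R) : open U -> (mu U < +oo)%E -> 0 < e ->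
  exists K, [/\ compact K, K `<=` U & (mu (U `\` K) <= e%:E)%E].
Proof.
move=> oU Uoo e0.
have fU : mu U \is a fin_num by rewrite ge0_fin_numE.
have [_ [K [cK KU] <-]] : exists2 x, [set mu K | K in [set K | compact K /\ K
  `<=` U]] x &
    (mu U - e%:E < x)%E.
  have := haar_inner haar_mu oU => Ue; have := fU; rewrite Ue.
  by move=> /(ub_ereal_sup_adherent e0).
move=> UK; exists K; split=> //.
have mK := borel_compact cK; have mU := borel_open oU.
have Koo : (mu K < +oo)%E by exact: haar_compact haar_mu _ cK.
rewrite measureD// setIidr//.
rewrite leeBlDr; last by rewrite ge0_fin_numE.
by rewrite -leeBlDl// ltW.
Qed.

(** Exhaust [U] by a compact [K] up to [e]. For [u] near 1, [u * K] stays in [U], so the difference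
    lies in the complement of [K] in [U]. *)
Lemma haar_open_near U (e : R) : open U -> (mu U < +oo)%E -> 0 < e ->
  \forall u \near (1%g : G), (mu (U `\` [set y | U (u * y)%g]) <= e%:E)%E.
Proof.
move=> oU Uoo e0; have [K [cK KU UK]] := haar_inner_approx oU Uoo e0.
have : \forall u \near (1%g : G), forall x, K x -> U (u * x)%g.
  apply: (@compact_near1 _ (fun x u => u * x)%g) => //.
  - by apply: continuous_mulg => z; [exact: cvg_snd|exact: cvg_fst].
  - by move=> x; rewrite mul1g.
have mK := borel_compact cK; have mU := borel_open oU.
apply: filterS => u uK; apply: le_trans UK.
apply: le_measure; rewrite ?inE.
- by apply: measurableD => //; apply: borel_open; exact: open_lmul.
- exact: measurableD.
- by move=> y [Uy nUy]; split=> // /uK.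
Qed.

Lemma haar_open_near2 U (e : R) : open U -> (mu U < +oo)%E -> 0 < e ->
  \forall u \near (1%g : G), (mu (U `\` [set y | U (u^-1 * y)%g]) <= e%:E)%E /\
    (mu ([set y | U (u^-1 * y)%g] `\` U) <= e%:E)%E.
Proof.
move=> oU Uoo e0; have H := haar_open_near oU Uoo e0; have H' := near1_inv H.
near=> u; split; first by near: u.
(* Translating the second difference by [u] turns it into the difference of [haar_open_near]. *)
rewrite -(haar_preimage u); last first.
  by apply: measurableD; apply: borel_open => //; exact: open_lmul.
rewrite (_ : [set y | _] = U `\` [set y | U (u * y)%g]); first by near: u.
by apply/seteqP; split=> y /=; rewrite mulKg.
Unshelve. all: by end_near. Qed.


(** These functions stand in for the nonnegative part of $C_c(G)$. The bound by 1 allows comparison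
    with indicators; compact support is encoded by a compact set containing all points where [f] is
    nonzero. *)
Definition test_fun (f : G -> R) := [/\ forall x, 0 <= f x <= 1, left_ucont f &
  exists2 K, compact K & forall x, f x != 0 -> K x].

(* The function z |-> mu (CW n zW) / mu W for a small neighborhood W of 1. *)
Lemma haar_bump C U : compact C -> open U -> C `<=` U ->
  exists f, [/\ test_fun f, forall x, C x -> f x = 1 & forall x, f x != 0 -> U x].
Proof.
move=> cC oU CU.
have CUnear : \forall u \near (1%g : G), forall x, C x -> U (x * u)%g.
  apply: (@compact_near1 _ (fun x u => x * u)%g) => //.
  - by apply: continuous_mulg => z; [exact: cvg_fst|exact: cvg_snd].
  - by move=> x; rewrite mulg1.
have [V cV nV] := compact_nbhs1 lcG.
have [[P Q] [/= nP nQ] PQ] : nbhs ((1, 1)%g : G * G)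
    (fun p : G * G => forall x, C x -> U (x * (p.1 * p.2^-1))%g).
  have cdiv : continuous (fun p : G * G => p.1 * p.2^-1)%g.
    apply: continuous_mulg => [z|]; first exact: cvg_fst.
    by apply: continuous_invg => z; exact: cvg_snd.
  have := cdiv (1, 1)%g (fun u => forall x, C x -> U (x * u)%g).
  by rewrite /= mulgV; apply.
(* By the choice of [P] and [Q], $C W W^{-1}$ lies in [U]. Being inside the compact [V], [W] has
   finite measure, and $C W W^{-1}$ lies in a compact set. Below, [tr z] is $zW$ and [A] is $CW$. *)
pose W := (P `&` Q `&` V)°.
have oW : open W by exact: open_interior.
have W1 : W 1%g by apply: filterI => //; exact: filterI.
have WV : W `<=` V by move=> x /interior_subset[].
have WP : W `<=` P by move=> x /interior_subset[[]].
have WQ : W `<=` Q by move=> x /interior_subset[[]].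
pose tr z := [set y | W (z^-1 * y)%g].
have otr z : open (tr z) by exact: open_lmul.
pose A := \bigcup_(c in C) tr c.
have oA : open A by apply: bigcup_open => c _; exact: otr.
have mtr z : mu (tr z) = mu W by rewrite /tr haar_preimage//; exact: borel_open.
have Woo : (mu W < +oo)%E.
  apply: le_lt_trans (haar_compact haar_mu cV).
  by apply: le_measure => //; rewrite inE; [exact: borel_open|exact: borel_compact].
have W0 : (0 < mu W)%E by apply: haar_open_gt0 => //; exists 1%g.
have m0 : 0 < fine (mu W) by apply: fine_gt0; rewrite W0.
have mAtr z : measurable (A `&` tr z : set (borel G)).
  by apply: measurableI; exact: borel_open.
have leAtr z : (mu (A `&` tr z) <= mu W)%E.
  rewrite -(mtr z); apply: le_measure; rewrite ?inE//; exact: borel_open.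
have fAtr z : mu (A `&` tr z) \is a fin_num.
  by rewrite ge0_fin_numE//; exact: le_lt_trans (leAtr z) Woo.
have fW : mu W \is a fin_num by rewrite ge0_fin_numE.
pose f z := fine (mu (A `&` tr z)) / fine (mu W).
have fAW x : f x != 0 -> exists c a b, [/\ C c, W a, W b & x = (c * (a * b^-1))%g].
  move=> fx0; have [y [[c Cc Wcy] Wxy]] : A `&` tr x !=set0.
    apply/set0P; apply: contra_neq fx0 => Ax.
    by rewrite /f Ax measure0/= mul0r.
  exists c, (c^-1 * y)%g, (x^-1 * y)%g; split=> //.
  by rewrite invgM invgK !mulgA mulgV mul1g mulgV mul1g.
exists f; split.
- split.
  + move=> x; rewrite /f divr_ge0 ?fine_ge0//= ler_pdivrMr// mul1r.
    by rewrite fine_le.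
  + move=> e e0; have e'0 : 0 < e * fine (mu W) by exact: mulr_gt0.
    have := haar_open_near2 oW Woo e'0; apply: filterS => u [Wu uW] z.
    have mW : measurable (W : set (borel G)) by exact: borel_open.
    have mWu : measurable ([set y | W (u^-1 * y)%g] : set (borel G)).
      by apply: borel_open; exact: open_lmul.
    (* The part of [A] in [tr z1] is covered by its part in [tr z2] and by the difference of the two
       translates, whose measure is at most [e] times that of [W]. *)
    have cmp z1 z2 : (mu (tr z1 `\` tr z2) <= (e * fine (mu W))%:E)%E -> f z1 <=
      f z2 + e.
      move=> h; rewrite /f -ler_pdivlMr ?invr_gt0// invrK mulrDl mulfVK ?gt_eqF//.
      rewrite -lee_fin EFinD !fineK//; apply: le_trans (leeD2l _ h).
      apply: le_trans (measureU2 _ _ _) => //; last first.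
        by apply: measurableD; exact: borel_open.
      apply: le_measure; rewrite ?inE//.
        apply: measurableU => //; by apply: measurableD; exact: borel_open.
      move=> y [Ay z1y]; have [z2y|z2y] := pselect (tr z2 y); [by left|by right].
    have trzu : tr (z * u)%g = [set y | W (u^-1 * (z^-1 * y))%g].
      by apply/seteqP; split=> y; rewrite /tr/= invgM mulgA.
    rewrite ler_distl lerBlDr; apply/andP; split.
      apply: cmp; rewrite trzu.
      have := @haar_preimage z^-1%g (W `\` [set y | W (u^-1 * y)%g]) (measurableD
        mW mWu).
      by rewrite /tr => /= ->.
    apply: cmp; rewrite trzu.
    have := @haar_preimage z^-1%g ([set y | W (u^-1 * y)%g] `\` W) (measurableD mWu mW).
    by rewrite /tr => /= ->.
  + exists [set c * ab | c in C & ab in [set a * b' | a in V & b' in [set b^-1 |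
    b in V]]]%g.
      by apply: compact_mulg => //; apply: compact_mulg => //; exact: compact_invg.
    move=> x /fAW[c [a [b [Cc Wa Wb ->]]]]; exists c => //; exists (a * b^-1)%g => //.
    by exists a; [exact: WV|exists b^-1%g => //; exists b => //; exact: WV].
- move=> x Cx; rewrite /f (_ : A `&` tr x = tr x) ?mtr ?divff ?gt_eqF//.
  by apply/seteqP; split=> [y []//|y xy]; split=> //; exists x.
- move=> x /fAW[c [a [b [Cc Wa Wb ->]]]].
  exact: (PQ (a, b) (conj (WP _ Wa) (WQ _ Wb)) c Cc).
Qed.

End haar.

(** * Fubini's theorem for compactly supported integrands *)

Section haar_fubini.
Variables (R : realType) (G : topologicalGroupType).
Variable mu : {measure set (borel G) -> \bar R}.
Hypothesis lcG : locally_compact_group G.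
Hypothesis haar_mu : left_haar mu.
Implicit Types (x y z u t : G) (A B K U V : set G).

Lemma integral_mfrestr (D : set (borel G)) (mD : measurable D) (Doo : (mu D < +oo)%E)
    (f : borel G -> \bar R) : (forall x, ~ D x -> f x = 0%E) ->
  (\int[mfrestr mD Doo]_x f x = \int[mu]_x f x)%E.
Proof.
move=> f0.
have fD : f = f \_ D.
  by apply/funext => x; rewrite patchE; case: ifPn => // /negP; rewrite inE => /f0.
rewrite [in LHS]fD [in RHS]fD -!integral_mkcond.
apply: eq_measure_integral => A mA AD; by rewrite /= /mfrestr /mrestr setIidl.
Qed.

(* A left uniformly continuous q is approximated on the compact set K by
   functions that are piecewise constant in x, which makes (x, y) |-> q (th y * x)
   measurable for the product sigma-algebra on the support of p. *)
Lemma measurable_shear (p q : G -> R) (th : G -> G) (K : set G) :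
  continuous th -> measurable_fun setT (p : borel G -> R) ->
  compact K -> (forall x, p x != 0 -> K x) -> left_ucont q ->
  measurable_fun setT
    ((fun xy => p xy.1 * q (th xy.2 * xy.1)%g) : borel G * borel G -> R).
Proof.
move=> cth mp cK pK uq.
have approx (n : nat) : exists h : (borel G * borel G)%type -> R,
    measurable_fun setT h /\
    forall x y, K x -> `|h (x, y) - q (th y * x)%g| <= n.+1%:R^-1.
  have n0 : 0 < n.+1%:R^-1 :> R by rewrite invr_gt0.
  pose W := (fun u => forall z, `|q (z * u)%g - q z| <= n.+1%:R^-1)°.
  have oW : open W by exact: open_interior.
  pose F (c : G) : set G := [set x | W (c^-1 * x)%g].
  have oF c : open (F c) by exact: open_lmul.
  have [s Ks] : exists s : seq G, K `<=` \bigcup_(c in [set` s]) F c.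
    apply: compact_open_cover => // x _; exists x.
    by rewrite /F/= mulVg; exact: (uq _ n0).
  suff [h [mh hP]] : exists h : (borel G * borel G)%type -> R, measurable_fun setT h /\
      forall x y, (exists2 c, c \in s & F c x) ->
        `|h (x, y) - q (th y * x)%g| <= n.+1%:R^-1.
    by exists h; split=> // x y /Ks[c cs Fcx]; apply: hP; exists c.
  (* Overlaps of the cover are resolved by priority: [F c] uses the center [c], and the rest of the
     list is consulted only off [F c]. *)
  elim: s {Ks} => [|c s [h [mh hP]]].
    by exists (cst 0); split=> [|x y [c]]; [exact: measurable_cst|rewrite in_nil].
  exists (fun xy => \1_(F c) xy.1 * q (th xy.2 * c)%g + (1 - \1_(F c) xy.1) * h xy).
  have mF : measurable_fun setT (fun xy : (borel G * borel G)%type =>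
    \1_(F c) xy.1 : R).
    apply: (@measurableT_comp _ _ _ _ _ _ (\1_(F c) : borel G -> R)) => //.
    by apply: measurable_indic; exact: borel_open.
  split.
    apply: measurable_funD; apply: measurable_funM => //; last first.
      by apply: measurable_funB => //; exact: measurable_cst.
    apply: (@measurableT_comp _ _ _ (borel G * borel G)%type (borel G) R (fun y
      => q (th y * c)%g) _ snd) => //.
    apply: borel_continuous => y.
    apply: (@continuous_comp _ _ _ (fun y => th y * c)%g q).
      by apply: continuous_mulg => //; exact: cst_continuous.
    exact: left_ucont_continuous.
  move=> x y [c' + Fc'x]; rewrite indicE /=.
  have [Fcx _|nFcx] := boolP (x \in F c).
    rewrite mul1r subrr mul0r addr0 distrC.
    have /interior_subset/(_ (th y * c)%g) := set_mem Fcx.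
    by rewrite -mulgA mulVKg.
  rewrite inE => /orP[/eqP c'c|c's]; last by rewrite mul0r add0r subr0 mul1r;
    apply: hP; exists c'.
  by move: nFcx; rewrite notin_setE -c'c.
have [h hP] := choice approx.
apply: (@measurable_fun_cvg _ (borel G * borel G)%type R setT (fun n xy =>
  p xy.1 * h n xy)).
  move=> n; apply: measurable_funM; last by case: (hP n).
  exact: measurableT_comp.
move=> [x y] _ /=; have [px0|px] := eqVneq (p x) 0.
  rewrite px0 mul0r (_ : (fun n => _) = cst 0); first exact: cvg_cst.
  by apply/funext => n; rewrite mul0r.
apply: cvgMr; apply/cvgrPdist_le => e e0.
near=> n; rewrite distrC; apply: (le_trans ((hP n).2 x y (pK x px))).
by apply: ltW; near: n; exact: near_infty_natSinv_lt (PosNum e0).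
Unshelve. all: by end_near. Qed.

(** Haar measure need not be sigma-finite, so Tonelli's theorem is applied to its finite
    restrictions to compact sets carrying the integrand. The map [th] will be the identity or
    inversion. *)
Lemma haar_fubini (p q : G -> R) (th : G -> G) (K L : set G) :
  continuous th -> involutive th ->
  measurable_fun setT (p : borel G -> R) -> (forall x, 0 <= p x) ->
  compact K -> (forall x, p x != 0 -> K x) ->
  left_ucont q -> (forall x, 0 <= q x) -> compact L -> (forall x, q x != 0 -> L x) ->
  (\int[mu]_x \int[mu]_y (p x * q (th y * x)%g)%:E =
   \int[mu]_y \int[mu]_x (p x * q (th y * x)%g)%:E)%E.
Proof.
move=> cth thK mp p0 cK pK uq q0 cL qL.
(* If [p x] and [q (th y * x)] are both nonzero, then [th y] lies in $L K^{-1}$, and [y] is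
   recovered since [th] is an involution. *)
pose M := th @` [set a * b | a in L & b in [set b^-1 | b in K]]%g.
have cM : compact M.
  by apply: compact_image_continuous => //; apply: compact_mulg => //;
    exact: compact_invg.
have pqM x y : ~ M y -> p x * q (th y * x)%g = 0.
  move=> nMy; apply/eqP; rewrite mulf_eq0 -implyNb; apply/implyP => px.
  apply: contra_notT nMy => qx; exists (th y); last exact: thK.
  exists (th y * x)%g; first exact: qL.
  by exists x^-1%g; [exists x => //; exact: pK|rewrite mulgK].
have mK := borel_compact lcG cK; have mM := borel_compact lcG cM.
have Koo := haar_compact haar_mu cK; have Moo := haar_compact haar_mu cM.
pose F (xy : borel G * borel G) : \bar R := (p xy.1 * q (th xy.2 * xy.1)%g)%:E.
have := @fubini_tonelli _ _ (borel G) (borel G) R (mfrestr mK Koo) (mfrestr mM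
  Moo) F _ _.
rewrite /F /= => H.
transitivity (\int[mfrestr mK Koo]_x \int[mfrestr mM Moo]_y (p x * q (th y *
  x)%g)%:E)%E.
  rewrite integral_mfrestr; last first.
    move=> x nKx; apply: integral0_eq => y _.
    have [-> |/pK//] := eqVneq (p x) 0; by rewrite mul0r.
  by apply: eq_integral => x _; rewrite integral_mfrestr// => y /pqM ->.
rewrite H; first last.
- by move=> [x y]; rewrite lee_fin mulr_ge0.
- by apply/measurable_EFinP; exact: measurable_shear cK pK uq.
rewrite integral_mfrestr; last first.
  by move=> y nMy; apply: integral0_eq => x _; rewrite pqM.
apply: eq_integral => y _; rewrite integral_mfrestr// => x nKx.
by have [-> |/pK//] := eqVneq (p x) 0; rewrite mul0r.
Qed.

End haar_fubini.

(** * The modular function *)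

Section haar_modular.
Variables (R : realType) (G : topologicalGroupType).
Variable mu : {measure set (borel G) -> \bar R}.
Hypothesis lcG : locally_compact_group G.
Hypothesis haar_mu : left_haar mu.
Implicit Types (x y z u t : G) (A B K U V : set G) (f g : G -> R).

Lemma continuous_mulgr z : continuous (fun y => y * z)%g.
Proof. by apply: continuous_mulg; [move=> ?; exact: cvg_id|exact: cst_continuous]. Qed.

Lemma test_fun_continuous f : test_fun f -> continuous f.
Proof. by case=> _ uf _; exact: left_ucont_continuous. Qed.

Lemma measurable_test_fun f (h : G -> G) : test_fun f -> continuous h ->
  measurable_fun setT (fun y : borel G => f (h y)).
Proof.
move=> tf ch; apply: borel_continuous => y; apply: (@continuous_comp _ _ _ h f).
  exact: ch.
exact: test_fun_continuous.
Qed.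

Lemma test_fun_le_indic f (h : G -> G) L : test_fun f ->
  (forall y, f (h y) != 0 -> L y) -> forall y, f (h y) <= \1_L y.
Proof.
move=> [f01 _ _] hL y; rewrite indicE; have [fy|fy] := eqVneq (f (h y)) 0.
  by rewrite fy.
by rewrite mem_set; [case/andP: (f01 (h y))|exact: hL].
Qed.

Lemma integral_test_fun_fin f (h h' : G -> G) : test_fun f -> continuous h ->
  continuous h' ->
  (forall y, h' (h y) = y) -> (\int[mu]_y (f (h y))%:E \is a fin_num)%E.
Proof.
move=> tf ch ch' hK; have [f01 uf [K cK fK]] := tf.
have cL : compact (h' @` K) by exact: compact_image_continuous.
have mL := borel_compact lcG cL.
rewrite ge0_fin_numE; last by apply: integral_ge0 => y _; rewrite lee_fin;
  case/andP: (f01 (h y)).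
apply: le_lt_trans (haar_compact haar_mu cL).
rewrite -(setIT (h' @` K)) -(integral_indic mu measurableT)//.
apply: ge0_le_integral => //.
- by move=> y _; rewrite lee_fin; case/andP: (f01 (h y)).
- by apply/measurable_EFinP; exact: measurable_test_fun.
- by apply/measurable_EFinP; exact: measurable_indic.
move=> y _; rewrite lee_fin; apply: (@test_fun_le_indic f h) => // z /fK Kz.
by exists (h z).
Qed.

(** For a test function this turns out to be [trint f 1] times the modular function at [z^-1]; the
    integral is then finite and [fine] loses nothing. *)
Definition trint f z : R := fine (\int[mu]_y (f (y * z)%g)%:E).

Lemma trintE f z : test_fun f -> (\int[mu]_y (f (y * z)%g)%:E = (trint f z)%:E)%E.
Proof.
move=> tf; rewrite /trint fineK//.
apply: (integral_test_fun_fin (h' := fun y => y * z^-1)%g tf);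
  [exact: continuous_mulgr..|].
by move=> y; rewrite mulgK.
Qed.

Lemma trint1E f : test_fun f -> (\int[mu]_y (f y)%:E = (trint f 1%g)%:E)%E.
Proof. by move=> tf; rewrite -trintE//; apply: eq_integral => y _; rewrite mulg1. Qed.

Lemma trint_ge0 f z : test_fun f -> 0 <= trint f z.
Proof.
by move=> [f01 _ _]; apply: fine_ge0; apply: integral_ge0 => y _;
  rewrite lee_fin; case/andP: (f01 (y * z)%g).
Qed.

Lemma trint_gt0 f x z : test_fun f -> f x = 1 -> 0 < trint f z.
Proof.
move=> tf fx1; have [f01 _ _] := tf.
pose O : set G := [set y | 2^-1 < f (y * z)%g].
have oO : open O.
  apply: (@open_comp_continuous _ _ (fun y => f (y * z)%g) [set r | 2^-1 < r]).
    move=> y; apply: (@continuous_comp _ _ _ (fun y => y * z)%g f);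
      first exact: continuous_mulgr.
    exact: test_fun_continuous.
  exact: open_gt.
have O0 : (0 < mu O)%E.
  apply: (haar_open_gt0 lcG) => //; exists (x * z^-1)%g.
  by rewrite /O/= mulgVK fx1 invf_lt1// ltr1n.
rewrite -lte_fin -trintE//; apply: (@lt_le_trans _ _ ((2^-1)%:E * mu O)%E).
  by rewrite mule_gt0.
have mO := borel_open oO.
rewrite -(setIT O) -(integral_indic mu measurableT)// -ge0_integralZl_EFin//;
  last first.
- by apply/measurable_EFinP; exact: measurable_indic.
apply: ge0_le_integral => //.
- by apply: measurable_funeM; apply/measurable_EFinP; exact: measurable_indic.
- by apply/measurable_EFinP; apply: measurable_test_fun => //; exact: continuous_mulgr.
move=> y _; rewrite -EFinM lee_fin indicE; have [yO|_] := boolP (y \in O).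
  by rewrite mulr1 ltW//; exact: set_mem yO.
by rewrite mulr0; case/andP: (f01 (y * z)%g).
Qed.

(** For [x = z * u] with [u] in [V], the translates by [x] and [z] vanish off one compact set [L]
    and differ uniformly by little, so their integrals are close. *)
Lemma trint_near f z (e : R) : test_fun f -> 0 < e ->
  \forall x \near z, `|trint f x - trint f z| <= e.
Proof.
move=> tf e0; have [f01 uf [K cK fK]] := tf.
have [V cV nV] := compact_nbhs1 lcG.
pose L := [set a * b | a in K & b in [set v^-1 * z^-1 | v in V]]%g.
have cL : compact L.
  apply: compact_mulg => //; apply: compact_image_continuous => //.
  by apply: continuous_mulg; [exact: invg_continuous|exact: cst_continuous].
have mL := borel_compact lcG cL; have Loo := haar_compact haar_mu cL.
have fL : mu L \is a fin_num by rewrite ge0_fin_numE.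
have L0 : 0 < fine (mu L) + 1 by rewrite ltr_wpDl// fine_ge0.
(* Adding 1 keeps the denominator positive even when [L] is null. *)
have d0 : 0 < e / (fine (mu L) + 1) by rewrite divr_gt0.
have := uf _ d0; set d := e / _ => ud.
have V1 : V 1%g by exact: nbhs_singleton nV.
have cmp x1 x2 : (forall y, f (y * x1)%g <= f (y * x2)%g + d * \1_L y) ->
    trint f x1 <= trint f x2 + e.
  move=> h; rewrite -lee_fin EFinD -!trintE//.
  apply: (@le_trans _ _ (\int[mu]_y ((f (y * x2)%g)%:E + (d * \1_L y)%:E))%E).
    apply: ge0_le_integral => //.
    - by move=> y _; rewrite lee_fin; case/andP: (f01 (y * x1)%g).
    - by apply/measurable_EFinP; apply: measurable_test_fun => //;
      exact: continuous_mulgr.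
    - apply: emeasurable_funD; apply/measurable_EFinP.
        by apply: measurable_test_fun => //; exact: continuous_mulgr.
      by apply: measurable_funM; [exact: measurable_cst|exact: measurable_indic].
    by move=> y _; rewrite -EFinD lee_fin.
  rewrite ge0_integralD//; last 4 first.
  - by move=> y _; rewrite lee_fin; case/andP: (f01 (y * x2)%g).
  - by apply/measurable_EFinP; apply: measurable_test_fun => //;
    exact: continuous_mulgr.
  - by move=> y _; rewrite lee_fin mulr_ge0// ltW.
  - by apply/measurable_EFinP; apply: measurable_funM;
    [exact: measurable_cst|exact: measurable_indic].
  apply: leeD2l; under eq_integral do rewrite EFinM.
  rewrite ge0_integralZl_EFin//; [|by apply/measurable_EFinP;
    exact: measurable_indic|exact: ltW].
  rewrite integral_indic// setIT -(fineK fL) -EFinM lee_fin /d -mulrA ger_pMr// mulrC.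
  by rewrite ler_pdivrMr// mul1r lerDl.
apply: near1_mul; near=> u.
have Vu : V u by near: u.
have du : forall z, `|f (z * u)%g - f z| <= d by near: u.
have ab y : `|f (y * (z * u))%g - f (y * z)%g| <= d * \1_L y.
  rewrite indicE; have [yL|] := boolP (y \in L).
    by rewrite mulr1 mulgA; exact: du.
  rewrite notin_setE => nLy; rewrite mulr0.
  have [->|/fK Kx] := eqVneq (f (y * (z * u))%g) 0; last first.
    case: nLy; exists (y * (z * u))%g => //; exists (u^-1 * z^-1)%g; first by exists u.
    by rewrite -invgM mulgK.
  have [->|/fK Kx] := eqVneq (f (y * z)%g) 0; first by rewrite subrr normr0.
  case: nLy; exists (y * z)%g => //; exists (1^-1 * z^-1)%g; first by exists 1%g.
  by rewrite invg1 mul1g mulgK.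
rewrite ler_distl lerBlDr; apply/andP; split; apply: cmp => y; have := ab y;
  by rewrite ler_distl lerBlDr => /andP[].
Unshelve. all: by end_near. Qed.

Lemma trint_continuous f : test_fun f -> continuous (trint f).
Proof.
move=> tf z; apply/(cvgrPdist_le (FF := nbhs_filter _)) => e e0.
by have := trint_near z tf e0; apply: filterS => x; rewrite distrC.
Qed.


Lemma measurable_trint f : test_fun f -> measurable_fun setT (trint f : borel G -> R).
Proof. by move=> tf; apply: borel_continuous; exact: trint_continuous. Qed.

Lemma integral_invgE g : test_fun g -> (\int[mu]_y (g y^-1%g)%:E \is a fin_num)%E.
Proof.
move=> tg; apply: (integral_test_fun_fin (h' := fun y => y^-1)%g tg);
  [exact: invg_continuous..|exact: invgK].
Qed.

(* Both sides are iterated integrals of f(x) g(y^-1 x). *)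
Lemma trint_inv f g : test_fun f -> test_fun g ->
  (\int[mu]_z (g z * trint f z)%:E = (trint f 1%g)%:E * \int[mu]_y (g y^-1%g)%:E)%E.
Proof.
move=> tf tg; have [f01 uf [K cK fK]] := tf; have [g01 ug [L cL gL]] := tg.
have f0 x : 0 <= f x by case/andP: (f01 x).
have g0 x : 0 <= g x by case/andP: (g01 x).
have cid : continuous (@id G) by move=> x; exact: cvg_id.
have mf : measurable_fun setT (f : borel G -> R) by exact: (measurable_test_fun tf cid).
have mg : measurable_fun setT (g : borel G -> R) by exact: (measurable_test_fun tg cid).
have mgV : measurable_fun setT (fun y : borel G => (g y^-1%g)%:E).
  by apply/measurable_EFinP; apply: measurable_test_fun => //; exact: invg_continuous.
transitivity (\int[mu]_y \int[mu]_z (g z * f (y * z)%g)%:E)%E.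
  rewrite -(haar_fubini lcG haar_mu (th := id) (K := L) (L := K))//.
  apply: eq_integral => z _; rewrite EFinM -trintE// -ge0_integralZl_EFin//.
  - by move=> y _; rewrite lee_fin.
  - by apply/measurable_EFinP; apply: measurable_test_fun => //;
    exact: continuous_mulgr.
(* Left invariance in the inner integral, with [x = y * z]. *)
transitivity (\int[mu]_y \int[mu]_x (f x * g (y^-1 * x)%g)%:E)%E.
  apply: eq_integral => y _.
  rewrite -(haar_integral haar_mu y (f := fun x => (f x * g (y^-1 * x)%g)%:E)).
  - by apply: eq_integral => z _; rewrite mulKg mulrC.
  - apply/measurable_EFinP; apply: measurable_funM => //;
    apply: measurable_test_fun => //.
    by apply: continuous_mulg => //; exact: cst_continuous.
  - by move=> x; rewrite lee_fin mulr_ge0.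
rewrite -(haar_fubini lcG haar_mu (th := fun y => y^-1%g) (K := K) (L := L))//;
  [|exact: invg_continuous|exact: invgK].
rewrite -trint1E// muleC -ge0_integralZl//; last 3 first.
- exact/measurable_EFinP.
- by move=> x _; rewrite lee_fin.
- by apply: integral_ge0 => y _; rewrite lee_fin.
apply: eq_integral => x _; under eq_integral do rewrite EFinM.
rewrite ge0_integralZl_EFin//; last 2 first.
- by move=> y _; rewrite lee_fin.
- apply/measurable_EFinP; apply: measurable_test_fun => //; apply: continuous_mulg.
    exact: invg_continuous.
  exact: cst_continuous.
rewrite muleC; congr (_ * _)%E.
(* Since $y^{-1}x = (x^{-1}y)^{-1}$, a left translation removes [x] from the inner integral. *)
rewrite -(haar_integral haar_mu x^-1%g mgV)//; last by move=> y; rewrite lee_fin.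
by apply: eq_integral => y _; rewrite invgM invgK.
Qed.


Lemma integral_test_trint_le g f c : test_fun g -> test_fun f -> 0 <= c ->
  (forall x, g x != 0 -> trint f x <= c) ->
  (\int[mu]_z (g z * trint f z)%:E <= (c * trint g 1%g)%:E)%E.
Proof.
move=> tg tf c0 fc; have [g01 _ _] := tg.
have cid : continuous (@id G) by move=> x; exact: cvg_id.
have mg : measurable_fun setT (g : borel G -> R) by exact: (measurable_test_fun tg cid).
have g0 x : 0 <= g x by case/andP: (g01 x).
rewrite EFinM -trint1E// -ge0_integralZl_EFin//; last 2 first.
- by move=> y _; rewrite lee_fin.
- exact/measurable_EFinP.
apply: ge0_le_integral => //.
- by move=> y _; rewrite lee_fin mulr_ge0// trint_ge0.
- by apply/measurable_EFinP; apply: measurable_funM => //; exact: measurable_trint.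
- by apply: measurable_funeM; exact/measurable_EFinP.
move=> x _; rewrite -EFinM lee_fin mulrC; have [->|gx] := eqVneq (g x) 0;
  first by rewrite !mulr0.
by rewrite ler_wpM2r// fc.
Qed.

Lemma integral_test_trint_ge g f c : test_fun g -> test_fun f -> 0 <= c ->
  (forall x, g x != 0 -> c <= trint f x) ->
  ((c * trint g 1%g)%:E <= \int[mu]_z (g z * trint f z)%:E)%E.
Proof.
move=> tg tf c0 fc; have [g01 _ _] := tg.
have cid : continuous (@id G) by move=> x; exact: cvg_id.
have mg : measurable_fun setT (g : borel G -> R) by exact: (measurable_test_fun tg cid).
have g0 x : 0 <= g x by case/andP: (g01 x).
rewrite EFinM -trint1E// -ge0_integralZl_EFin//; last 2 first.
- by move=> y _; rewrite lee_fin.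
- exact/measurable_EFinP.
apply: ge0_le_integral => //.
- by move=> y _; rewrite -EFinM lee_fin mulr_ge0.
- by apply: measurable_funeM; exact/measurable_EFinP.
- by apply/measurable_EFinP; apply: measurable_funM => //; exact: measurable_trint.
move=> x _; rewrite -EFinM lee_fin mulrC; have [->|gx] := eqVneq (g x) 0;
  first by rewrite !mul0r.
by rewrite ler_wpM2l// fc.
Qed.

(* If the two sides differed at z, they would differ by a definite amount near z;
   integrate against a bump function supported near z. *)
Lemma trint_ratio f1 f2 z : test_fun f1 -> test_fun f2 ->
  trint f1 z * trint f2 1%g = trint f2 z * trint f1 1%g.
Proof.
suff H h1 h2 : test_fun h1 -> test_fun h2 ->
    trint h1 z * trint h2 1%g <= trint h2 z * trint h1 1%g.
  by move=> t1 t2; apply/eqP; rewrite eq_le !H.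
move=> t1 t2; rewrite leNgt; apply/negP => lt12.
set i1 := trint h1 1%g in lt12 *; set i2 := trint h2 1%g in lt12 *.
set d1 := trint h1 z in lt12 *; set d2 := trint h2 z in lt12 *.
have i10 : 0 <= i1 by exact: trint_ge0.
have i20 : 0 <= i2 by exact: trint_ge0.
have d10 : 0 <= d1 by exact: trint_ge0.
have d20 : 0 <= d2 by exact: trint_ge0.
have s0 : 0 < i1 + i2 + 1 by rewrite ltr_wpDl// addr_ge0.
(* With this [e], the gap [d1 * i2 - d2 * i1] equals [e * (i1 + i2 + 1)], whereas the bump function
   bounds it by [e * (i1 + i2)]. *)
pose e := (d1 * i2 - d2 * i1) / (i1 + i2 + 1).
have e0 : 0 < e by rewrite divr_gt0// subr_gt0.
pose U := [set x | `|trint h1 x - d1| <= e /\ `|trint h2 x - d2| <= e]°.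
have oU : open U by exact: open_interior.
have Uz : U z by apply: filterI; exact: trint_near.
have cz : compact [set z] by exact: compact_set1.
have zU : [set z] `<=` U by move=> _ ->.
have [g [tg gz gU]] := haar_bump lcG haar_mu cz oU zU.
have G0 : 0 < trint g 1%g by exact: (trint_gt0 _ tg (gz z erefl)).
have Ule x : U x -> d1 - e <= trint h1 x /\ trint h2 x <= d2 + e.
  by move=> /interior_subset[]; rewrite !ler_distl => /andP[? _] /andP[_ ?].
(* The lower bound [d1 - e] may be negative, while [integral_test_trint_ge] asks for a nonnegative
   constant. *)
have c0 : 0 <= Num.max 0 (d1 - e) by rewrite le_max lexx.
have h1c x : g x != 0 -> Num.max 0 (d1 - e) <= trint h1 x.
  by move=> /gU/Ule[? _]; rewrite ge_max trint_ge0.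
have h2c x : g x != 0 -> trint h2 x <= d2 + e by move=> /gU/Ule[].
have d2e0 : 0 <= d2 + e by rewrite addr_ge0// ltW.
have := integral_test_trint_ge tg t1 c0 h1c.
have := integral_test_trint_le tg t2 d2e0 h2c.
rewrite !trint_inv// -(fineK (integral_invgE tg)) -!EFinM !lee_fin -/i1 -/i2.
set J := fine _ => le2 le1.
(* Both bounds contain the same integral [J] of [g] composed with inversion; multiplying the first
   by [i2] and the second by [i1] eliminates it. *)
have : i2 * (d1 - e) <= i1 * (d2 + e).
  rewrite -(ler_pM2r G0); apply: (@le_trans _ _ (i2 * (i1 * J))).
    rewrite -mulrA ler_wpM2l//; apply: le_trans le1.
    by apply: ler_wpM2r; [exact: ltW|rewrite le_max lexx orbT].
  by rewrite mulrCA -mulrA ler_wpM2l.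
apply/negP; rewrite -ltNge.
have : e * (i1 + i2 + 1) = d1 * i2 - d2 * i1 by rewrite /e mulfVK ?gt_eqF.
by move: e0; clear; nra.
Qed.

(** [D] is the modular function at [t]: one bump function defines it, and [trint_ratio] makes it the
    same for every test function. *)
Lemma trint_modular t : exists D : R, 0 < D /\
  forall f, test_fun f -> trint f t^-1%g = D * trint f 1%g.
Proof.
have c1 : compact [set (1 : G)%g] by exact: compact_set1.
have [f [tf f1 _]] := haar_bump lcG haar_mu c1 openT (@subsetT _ _).
have f10 : 0 < trint f 1%g by exact: (trint_gt0 _ tf (f1 1%g erefl)).
exists (trint f t^-1%g / trint f 1%g); split.
  by rewrite divr_gt0//; exact: (trint_gt0 _ tf (f1 1%g erefl)).
move=> g tg; apply: (mulIf (lt0r_neq0 f10)).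
by rewrite (trint_ratio _ tg tf) mulrAC mulfVK ?gt_eqF.
Qed.

Lemma le_integral_test_fun f (h : G -> G) (O : set G) : test_fun f -> continuous h ->
  measurable (O : set (borel G)) -> (forall y, f (h y) != 0 -> O y) ->
  (\int[mu]_y (f (h y))%:E <= mu O)%E.
Proof.
move=> tf ch mO fO; have [f01 _ _] := tf.
rewrite -[in leRHS](setIT O) -(integral_indic mu measurableT)//.
apply: ge0_le_integral => //.
- by move=> y _; rewrite lee_fin; case/andP: (f01 (h y)).
- by apply/measurable_EFinP; exact: measurable_test_fun.
- by apply/measurable_EFinP; exact: measurable_indic.
by move=> y _; rewrite lee_fin; exact: (@test_fun_le_indic f h).
Qed.

Lemma ge_integral_test_fun f (h : G -> G) (K : set G) : test_fun f -> continuous h ->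
  measurable (K : set (borel G)) -> (forall y, K y -> f (h y) = 1) ->
  (mu K <= \int[mu]_y (f (h y))%:E)%E.
Proof.
move=> tf ch mK fK; have [f01 _ _] := tf.
rewrite -[in leLHS](setIT K) -(integral_indic mu measurableT)//.
apply: ge0_le_integral => //.
- by apply/measurable_EFinP; exact: measurable_indic.
- by apply/measurable_EFinP; exact: measurable_test_fun.
move=> y _; rewrite lee_fin indicE; have [yK|_] := boolP (y \in K).
  by rewrite fK//; exact: set_mem yK.
by case/andP: (f01 (h y)).
Qed.


(** Bump functions squeezed between compact and open sets carry [trint_modular] over to open sets by
    inner regularity; outer regularity then extends it to Borel sets. *)
Lemma haar_modular t : exists D : R, 0 < D /\
  forall A, measurable (A : set (borel G)) ->
    mu [set y | A (y * t^-1)%g] = (D%:E * mu A)%E.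
Proof.
have [D [D0 DP]] := trint_modular t; exists D; split=> // A mA.
have cid : continuous (@id G) by move=> x; exact: cvg_id.
have oR U x : open U -> open [set y | U (y * x)%g].
  by move=> oU; apply: open_comp_continuous oU; exact: continuous_mulgr.
have openE U : open U -> mu [set y | U (y * t^-1)%g] = (D%:E * mu U)%E.
  move=> oU; apply/eqP; rewrite eq_le; apply/andP; split.
    rewrite (haar_inner haar_mu (oR _ _ oU)); apply: ge_ereal_sup => _ [K [cK KU] <-].
    have cKt : compact [set k * t^-1 | k in K]%g.
      by apply: compact_image_continuous cK; exact: continuous_mulgr.
    have [f [tf f1 fU]] : exists f, [/\ test_fun f,
        forall x, [set k * t^-1 | k in K]%g x -> f x = 1 & forall x, f x != 0 -> U x].
      by apply: (haar_bump lcG haar_mu cKt oU) => _ [k Kk <-]; exact: KU.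
    apply: (@le_trans _ _ (trint f t^-1%g)%:E).
      rewrite -trintE//; apply: (@ge_integral_test_fun f (fun y => y * t^-1)%g) => //.
      - exact: continuous_mulgr.
      - exact: borel_compact.
      - by move=> y Ky; apply: f1; exists y.
    rewrite DP// EFinM; apply: lee_wpmul2l; first by rewrite lee_fin ltW.
    rewrite -trint1E//; exact: (@le_integral_test_fun f id U tf cid (borel_open oU) fU).
  rewrite -lee_pdivlMl// (haar_inner haar_mu oU);
    apply: ge_ereal_sup => _ [K [cK KU] <-].
  have [f [tf f1 fU]] := haar_bump lcG haar_mu cK oU KU.
  rewrite lee_pdivlMl//; apply: (@le_trans _ _ (D%:E * (trint f 1%g)%:E)%E).
    apply: lee_wpmul2l; first by rewrite lee_fin ltW.
    rewrite -trint1E//.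
    by apply: (@ge_integral_test_fun f id) => //; exact: borel_compact.
  rewrite -EFinM -DP// -trintE//;
    apply: (@le_integral_test_fun f (fun y => y * t^-1)%g) => //.
  - exact: continuous_mulgr.
  - by apply: borel_open; exact: oR.
  - by move=> y; exact: fU.
have mAt : measurable ([set y | A (y * t^-1)%g] : set (borel G)).
  rewrite -[X in measurable X]setTI.
  by apply: (borel_homeo (f := fun y => y * t^-1)%g (@continuous_mulgr _)).
apply/eqP; rewrite eq_le; apply/andP; split.
  rewrite -lee_pdivrMl// (haar_outer haar_mu mA).
  apply: le_ereal_inf_tmp => _ [U [oU AU] <-]; rewrite lee_pdivrMl// -openE//.
  apply: le_measure; rewrite ?inE//; first by apply: borel_open; exact: oR.
  by move=> y; exact: AU.
rewrite (haar_outer haar_mu mAt); apply: le_ereal_inf_tmp => _ [U [oU AU] <-].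
(* An open set containing $At$ is the right translate by [t] of the open set $Ut^{-1}$, which
   contains [A]. *)
rewrite (_ : U = [set y | [set z | U (z * t)%g] (y * t^-1)%g]); last first.
  by apply/seteqP; split=> y; rewrite /= mulgVK.
rewrite openE; last exact: oR.
apply: lee_wpmul2l; [by rewrite lee_fin ltW|apply: le_measure]; rewrite ?inE//.
  by apply: borel_open; exact: oR.
by move=> y Ay; apply: AU; rewrite /= mulgK.
Qed.

(** On the open set [V n] the function [trint f] is bounded, so by [trint_inv] inversion multiplies
    the measure of open subsets of [V n] by at most a constant. Outer regularity passes this on to
    null sets, and the [V n] exhaust [G]. *)
Lemma haar_inv_null A : measurable (A : set (borel G)) -> mu A = 0%E ->
  mu [set y | A y^-1%g] = 0%E.
Proof.
move=> mA A0.
have cid : continuous (@id G) by move=> x; exact: cvg_id.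
have cinv : continuous (fun x : G => x^-1%g) by exact: invg_continuous.
have c1 : compact [set (1 : G)%g] by exact: compact_set1.
have [f [tf f1 _]] := haar_bump lcG haar_mu c1 openT (@subsetT _ _).
have f10 : 0 < trint f 1%g by exact: (trint_gt0 _ tf (f1 1%g erefl)).
pose V (n : nat) : set G := [set z | trint f z < n.+1%:R].
have oV n : open (V n).
  exact: (open_comp_continuous (trint_continuous tf) (@open_lt _ n.+1%:R)).
have oI U : open U -> open [set y | U y^-1%g].
  by move=> oU; exact: open_comp_continuous oU.
have mI B : measurable (B : set (borel G)) ->
    measurable ([set y | B y^-1%g] : set (borel G)).
  move=> mB; rewrite -[X in measurable X]setTI; exact: (borel_homeo cinv).
have openE U n : open U -> U `<=` V n ->
    ((trint f 1%g / n.+1%:R)%:E * mu [set y | U y^-1%g] <= mu U)%E.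
  move=> oU UV; have c0 : 0 < trint f 1%g / n.+1%:R by rewrite divr_gt0.
  rewrite -lee_pdivlMl// (haar_inner haar_mu (oI _ oU)).
  apply: ge_ereal_sup => _ [K [cK KU] <-]; rewrite lee_pdivlMl//.
  have [g [tg g1 gU]] : exists g, [/\ test_fun g,
      forall x, [set k^-1 | k in K]%g x -> g x = 1 & forall x, g x != 0 -> U x].
    by apply: (haar_bump lcG haar_mu (compact_invg cK) oU) => _ [k Kk <-]; exact: KU.
  apply: (@le_trans _ _ (trint g 1%g)%:E); last first.
    by rewrite -trint1E//; apply: (@le_integral_test_fun g id) => //; exact: borel_open.
  rewrite mulrC EFinM -muleA lee_pdivrMl// -EFinM.
  apply: (@le_trans _ _ ((trint f 1%g)%:E * \int[mu]_y (g y^-1%g)%:E)%E).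
    apply: lee_wpmul2l; first by rewrite lee_fin ltW.
    apply: (@ge_integral_test_fun g (fun y => y^-1)%g) => //.
    - exact: borel_compact.
    - by move=> y Ky; apply: g1; exists y.
  rewrite -trint_inv//; apply: integral_test_trint_le => // x /gU/UV/ltW.
  by [].
have null n : mu [set y | (A `&` V n) y^-1%g] = 0%E.
  have c0 : 0 < trint f 1%g / n.+1%:R by rewrite divr_gt0.
  apply/eqP; rewrite -measure_le0.
  (* Zero is written as a multiple of [mu A], so that outer regularity leaves one inequality for
     each open [U] containing [A]. *)
  have -> : 0%E = ((trint f 1%g / n.+1%:R)^-1%:E * mu A)%E by rewrite A0 mule0.
  rewrite lee_pdivlMl// (haar_outer haar_mu mA).
  apply: le_ereal_inf_tmp => _ [U [oU AU] <-].
  have oUV : open (U `&` V n) by exact: openI.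
  apply: (@le_trans _ _ (mu (U `&` V n))).
    apply: le_trans (openE _ n oUV (@subIsetr _ _ _)).
    apply: lee_wpmul2l; [by rewrite lee_fin ltW|apply: le_measure]; rewrite ?inE.
    - by apply: mI; apply: measurableI => //; exact: borel_open.
    - by apply: borel_open; exact: oI.
    - by move=> y [/AU].
  by apply: le_measure; rewrite ?inE; [exact: borel_open..|exact: subIsetl].
apply: measure_negligible; first exact: mI.
have -> : [set y | A y^-1%g] = \bigcup_n [set y | (A `&` V n) y^-1%g].
  apply/seteqP; split=> [y Ay|y [n _ []//]].
  exists (Num.truncn (trint f y^-1%g)) => //; split=> //.
  exact: truncnS_gt.
apply: negligible_bigcup => n.
have mAV : measurable ([set y | (A `&` V n) y^-1%g] : set (borel G)).
  by apply: mI; apply: measurableI => //; exact: borel_open.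
by have [_ +] := @negligibleP _ (borel G) R mu _ mAV; apply; exact: null.
Qed.

End haar_modular.

(** * Right translations on weighted L1 *)

#[local] Instance filter_ae_borel (R : realType) (G : topologicalGroupType)
  (mu : {measure set (borel G) -> \bar R}) : Filter (nbhs (almost_everywhere mu)).
Proof. exact: (ae_filter_ringOfSetsType mu). Qed.

Section weighted_translation.
Variables (R : realType) (G : topologicalGroupType).
Variables (mu : {measure set (borel G) -> \bar R}) (w : weight R G).
Hypothesis lcG : locally_compact_group G.
Hypothesis haar_mu : left_haar mu.
Implicit Types (f g : G -> R[i]).

Definition rtrans (c : R) (t : G) f : G -> R[i] := fun x => (c%:C)%C * f (x * t^-1)%g.

Lemma Re_realM (c : R) (z : R[i]) : complex.Re ((c%:C)%C * z) = c * complex.Re z.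
Proof. by case: z => a b /=; rewrite mul0r subr0. Qed.

Lemma Im_realM (c : R) (z : R[i]) : complex.Im ((c%:C)%C * z) = c * complex.Im z.
Proof. by case: z => a b /=; rewrite mul0r addr0. Qed.

Lemma cmeasurable_comp (h : G -> G) f : continuous h -> cmeasurable f ->
  cmeasurable (f \o h).
Proof.
move=> /borel_homeo mh [fr fi]; split;
  [exact: (measurableT_comp fr mh)|exact: (measurableT_comp fi mh)].
Qed.

Lemma cmeasurable_rtrans c t f : cmeasurable f -> cmeasurable (rtrans c t f).
Proof.
move=> mf.
have := cmeasurableZ (c%:C)%C (cmeasurable_comp (@continuous_mulgr G t^-1%g) mf).
exact.
Qed.

Lemma cmeasurable_mul f g : cmeasurable f -> cmeasurable g ->
  cmeasurable (fun x => f x * g x).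
Proof.
move=> [fr fi] [gr gi]; split.
  rewrite (_ : _ \o _ = (fun x => complex.Re (f x) * complex.Re (g x) -
      complex.Im (f x) * complex.Im (g x))).
    by apply: measurable_funB; exact: measurable_funM.
  by apply/funext => x /=; case: (f x) (g x) => ? ? [].
rewrite (_ : _ \o _ = (fun x => complex.Re (f x) * complex.Im (g x) +
    complex.Im (f x) * complex.Re (g x))).
  by apply: measurable_funD; exact: measurable_funM.
by apply/funext => x /=; case: (f x) (g x) => ? ? [].
Qed.

Lemma cnorm_realM (c : R) (z : R[i]) : 0 <= c -> cnorm ((c%:C)%C * z) = c * cnorm z.
Proof.
move=> c0; rewrite ComplexField.Normc.normcM; congr (_ * _).
by rewrite /cnorm/= expr0n addr0 sqrtr_sqr ger0_norm.
Qed.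

(** Both terms may be infinite: the library's value of [+oo - +oo] is unchanged by a positive
    factor. *)
Lemma pos_muleBr (c : R) (x y : \bar R) : 0 < c -> (0 <= x)%E -> (0 <= y)%E ->
  (c%:E * (x - y) = c%:E * x - c%:E * y)%E.
Proof.
move=> c0; case: x => [x| |]; case: y => [y| |] // _ _.
- by rewrite -EFinB -!EFinM mulrBr.
- by rewrite [in RHS]gt0_muley ?lte_fin// -EFinM /= gt0_muleNy ?lte_fin.
- by rewrite [in RHS]gt0_muley ?lte_fin// -EFinM /= gt0_muley ?lte_fin.
- by rewrite [in RHS]gt0_muley ?lte_fin//= gt0_muleNy ?lte_fin.
Qed.

Lemma RintegralZl_pos (c : R) (h : borel G -> R) : 0 < c -> measurable_fun setT h ->
  \int[mu]_s (c * h s) = c * \int[mu]_s h s.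
Proof.
move=> c0 mh; have c0' := ltW c0;
  have mh' : measurable_fun setT (EFin \o h) by exact/measurable_EFinP.
rewrite /Rintegral.
have -> : (\int[mu]_s (c * h s)%:E = c%:E * \int[mu]_s (h s)%:E)%E.
  rewrite integralE [in RHS]integralE.
  rewrite (_ : (fun x => (c * h x)%:E) = (fun x => c%:E * (EFin \o h) x)%E)//.
  rewrite ge0_funeposM// ge0_funenegM// pos_muleBr//; last 2 first.
  - by apply: integral_ge0 => x _; exact: funepos_ge0.
  - by apply: integral_ge0 => x _; exact: funeneg_ge0.
  by rewrite !ge0_integralZl_EFin//;
    [exact: measurable_funeneg|exact: measurable_funepos].
(* An infinite integral stays infinite after scaling, and [fine] sends it to 0 on both sides. *)
by case: (\int[mu]_s (h s)%:E)%E => [x| |] //=;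
  rewrite ?gt0_muley ?gt0_muleNy ?lte_fin//= mulr0.
Qed.

(* No integrability is needed: for c > 0, scaling by c also preserves the junk
   value 0 of a divergent integral. *)
Lemma convolution_rtrans c t f g : 0 < c -> cmeasurable f -> cmeasurable g ->
  convolution mu f (rtrans c t g) = rtrans c t (convolution mu f g).
Proof.
move=> c0 mf mg; apply/funext => x; rewrite /rtrans /convolution.
have mfg : cmeasurable (fun s => f s * g (s^-1 * (x * t^-1))%g).
  apply: cmeasurable_mul => //.
  apply: (@cmeasurable_comp (fun s => s^-1 * (x * t^-1))%g) => //.
  by apply: continuous_mulg; [exact: invg_continuous|exact: cst_continuous].
have [mr mi] := mfg.
have E s : f s * ((c%:C)%C * g (s^-1 * x * t^-1)%g) =
    (c%:C)%C * (f s * g (s^-1 * (x * t^-1))%g) by rewrite mulgA mulrCA.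
apply/eqP; rewrite eq_complex; apply/andP; split; apply/eqP.
  rewrite Re_realM /= -RintegralZl_pos//.
  by congr (fine _); apply: eq_integral => s _; rewrite E Re_realM.
rewrite Im_realM /= -RintegralZl_pos//.
by congr (fine _); apply: eq_integral => s _; rewrite E Im_realM.
Qed.

(* Inversion preserves null sets, so that every value of the convolution, and not
   just almost every one, only depends on the class of g. *)
Lemma convolution_ae_eq f g1 g2 : cmeasurable f -> cmeasurable g1 -> cmeasurable g2 ->
  (\forall t \ae mu, g1 t = g2 t) -> convolution mu f g1 = convolution mu f g2.
Proof.
move=> mf mg1 mg2 [N [mN N0 g12N]]; apply/funext => x.
have mfg g : cmeasurable g -> cmeasurable (fun s => f s * g (s^-1 * x)%g).
  move=> mg; apply: cmeasurable_mul => //.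
  apply: (@cmeasurable_comp (fun s => s^-1 * x)%g) => //.
  by apply: continuous_mulg; [exact: invg_continuous|exact: cst_continuous].
have [mr1 mi1] := mfg _ mg1; have [mr2 mi2] := mfg _ mg2.
have aeq : \forall s \ae mu, f s * g1 (s^-1 * x)%g = f s * g2 (s^-1 * x)%g.
  pose B : set G := [set s | N (s^-1)%g].
  have mB : measurable (B : set (borel G)).
    rewrite -[X in measurable X]setTI.
    exact: (borel_homeo (@invg_continuous G)).
  (* The exceptional set is $x N^{-1}$, null by [haar_inv_null] and left invariance. *)
  exists [set s | B (x^-1 * s)%g]; split.
  - rewrite -[X in measurable X]setTI.
    apply: (borel_homeo (f := fun s => x^-1 * s)%g) => //.
    by apply: continuous_mulg; [exact: cst_continuous|move=> ?; exact: cvg_id].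
  - by rewrite haar_preimage//; exact: haar_inv_null.
  - move=> s /= ns; rewrite /B/= invgM invgK; apply: g12N => /= e.
    by apply: ns; rewrite e.
rewrite /convolution; congr (Complex (fine _) (fine _)); apply: ae_eq_integral => //;
  try exact/measurable_EFinP.
- by move: aeq; apply: filterS => s -> _.
- by move: aeq; apply: filterS => s -> _.
Qed.

End weighted_translation.

(** * Normalized right translation as a multiplier *)

Section translation_operator.
Variables (R : realType) (G : topologicalGroupType).
Variables (mu : {measure set (borel G) -> \bar R}) (w : weight R G).
Hypothesis lcG : locally_compact_group G.
Hypothesis haar_mu : left_haar mu.
Variables (t : G) (D : R).
Hypothesis D0 : 0 < D.
Hypothesis DE : forall A : set G, measurable (A : set (borel G)) ->
  mu [set y | A (y * t^-1)%g] = (D%:E * mu A)%E.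
Implicit Types (f g : G -> R[i]).

(** The factor [D] offsets the change of Haar measure, and [w t] the growth of the weight. *)
Let c : R := (D * w t)^-1.

Let c0 : 0 < c. Proof. by rewrite invr_gt0 mulr_gt0// weight_gt0. Qed.

Lemma integral_rtrans (h : G -> \bar R) : measurable_fun setT (h : borel G -> \bar R) ->
  (forall y, (0 <= h y)%E) -> (\int[mu]_y h (y * t^-1)%g = D%:E * \int[mu]_y h y)%E.
Proof.
move=> mh h0.
have mt : measurable_fun setT ((fun y => y * t^-1)%g : borel G -> borel G).
  by apply: borel_homeo; exact: continuous_mulgr.
have := @ge0_integral_pushforward _ _ _ _ _ _ mt mu setT h measurableT mh (fun y
  _ => h0 y).
rewrite preimage_setT => <-.
have D0' : 0 <= D by exact: ltW.
rewrite -(ge0_integral_mscale mu measurableT (NngNum D0') mh)//.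
by apply: eq_measure_integral => A mA _; rewrite /pushforward /= /mscale/=; exact: DE.
Qed.

Lemma measurable_cnorm f : cmeasurable f ->
  measurable_fun setT (fun y : borel G => cnorm (f y)).
Proof.
move=> [fr fi]; rewrite (_ : (fun y => _) = @Num.sqrt R \o
    ((fun y => (@complex.Re R \o f) y ^+ 2) \+ (fun y => (@complex.Im R \o f) y ^+ 2))).
  apply: measurableT_comp.
    by apply: continuous_measurable_fun; exact: sqrt_continuous.
  by apply: measurable_funD; exact: measurable_funX.
by apply/funext => y /=; case: (f y).
Qed.

Lemma measurable_wtrans (k : R) f : cmeasurable f ->
  measurable_fun setT (fun y : borel G => (k * (w (y * t)%g * cnorm (f y)))%:E).
Proof.
move=> mf; apply/measurable_EFinP; apply: measurable_funM; first exact: measurable_cst.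
apply: measurable_funM; last exact: measurable_cnorm.
apply: borel_continuous => y; apply: (@continuous_comp _ _ _ (fun y => y * t)%g w).
  exact: continuous_mulgr.
exact: weight_continuous.
Qed.

(** After the change of variable [D] cancels and the weight becomes [w (y * t) / w t].
    Submultiplicativity bounds it above by [w y], diagonal boundedness below by [w y / K]. *)
Lemma wnorm_rtrans f : cmeasurable f ->
  wnorm mu w (rtrans c t f) = (\int[mu]_y ((w t)^-1 * (w (y * t)%g * cnorm (f
    y)))%:E)%E.
Proof.
move=> mf.
have mh : measurable_fun setT
    (fun y : borel G => (c * (w (y * t)%g * cnorm (f y)))%:E).
  exact: measurable_wtrans.
transitivity (\int[mu]_x (fun y =>
  (c * (w (y * t)%g * cnorm (f y)))%:E) (x * t^-1)%g)%E.
  apply: eq_integral => x _; rewrite /wintegrand /rtrans mulgVK cnorm_realM;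
    last exact: ltW.
  by rewrite mulrCA.
rewrite (integral_rtrans mh); last first.
  by move=> y; rewrite lee_fin mulr_ge0 ?(ltW c0)// mulr_ge0 ?cnorm_ge0// ltW//
    weight_gt0.
rewrite -ge0_integralZl_EFin//; last 2 first.
- by move=> y _; rewrite lee_fin mulr_ge0 ?(ltW c0)// mulr_ge0 ?cnorm_ge0// ltW//
  weight_gt0.
- exact: ltW.
apply: eq_integral => y _; rewrite -EFinM /c invfM !mulrA mulfV ?mul1r//.
by rewrite gt_eqF.
Qed.

Lemma wnorm_rtrans_le f : cmeasurable f -> (wnorm mu w (rtrans c t f) <= wnorm mu
  w f)%E.
Proof.
move=> mf; have wt0 := weight_gt0 w t; rewrite wnorm_rtrans//.
apply: ge0_le_integral => //.
- by move=> y _; rewrite lee_fin mulr_ge0 ?invr_ge0 ?(ltW wt0)//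
  mulr_ge0 ?cnorm_ge0// ltW// weight_gt0.
- exact: measurable_wtrans.
- exact: measurable_wintegrand.
move=> y _; rewrite lee_fin mulrA ler_wpM2r ?cnorm_ge0//.
by rewrite ler_pdivrMl// mulrC weight_submul.
Qed.

Lemma wnorm_rtrans_ge (K : R) f : 0 < K -> (forall s t, w s * w t <= K * w (s * t)%g) ->
  cmeasurable f -> (wnorm mu w f <= K%:E * wnorm mu w (rtrans c t f))%E.
Proof.
move=> K0 wK mf; have wt0 := weight_gt0 w t; rewrite wnorm_rtrans//.
rewrite -ge0_integralZl_EFin//; last 3 first.
- by move=> y _; rewrite lee_fin mulr_ge0 ?invr_ge0 ?(ltW wt0)//
  mulr_ge0 ?cnorm_ge0// ltW// weight_gt0.
- exact: measurable_wtrans.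
- exact: ltW.
apply: ge0_le_integral => //.
- by move=> y _; exact: wintegrand_ge0.
- exact: measurable_wintegrand.
- by apply: measurable_funeM; exact: measurable_wtrans.
move=> y _; rewrite -EFinM lee_fin mulrA mulrA ler_wpM2r ?cnorm_ge0//.
by rewrite mulrAC ler_pdivlMr.
Qed.


Lemma wL1_rtrans f : f \in wL1 mu w -> rtrans c t f \in wL1 mu w.
Proof.
move=> /wL1P[mf nf]; apply/wL1P; split; first exact: cmeasurable_rtrans.
exact: le_lt_trans (wnorm_rtrans_le mf) nf.
Qed.

(** Used in [L1_trans_mul] to show that a convolution outside [wL1] has its translate outside
    too. *)
Lemma wL1_rtransV (K : R) f : 0 < K -> (forall s t, w s * w t <= K * w (s * t)%g) ->
  rtrans c t f \in wL1 mu w -> f \in wL1 mu w.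
Proof.
move=> K0 wK /wL1P[mf nf].
have mf' : cmeasurable f.
  have := cmeasurable_rtrans c^-1 t^-1%g mf.
  rewrite (_ : rtrans _ _ _ = f)//; apply/funext => x;
    rewrite /rtrans invgK mulgK mulrA.
  by rewrite -(rmorphM (real_complex R)) mulVf ?gt_eqF// mul1r.
apply/wL1P; split=> //; apply: le_lt_trans (wnorm_rtrans_ge K0 wK mf') _.
by rewrite lte_mul_pinfty// lee_fin ltW.
Qed.

Definition L1fun_trans (f : L1fun mu w) : L1fun mu w := L1Fun (wL1_rtrans (L1funP f)).

Definition L1_trans (a : L1 mu w) : L1 mu w := \pi_(L1 mu w)%qT (L1fun_trans (repr a)).

Lemma ae_rtrans f g : (\forall x \ae mu, f x = g x) ->
  \forall x \ae mu, rtrans c t f x = rtrans c t g x.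
Proof.
move=> [N [mN N0 fgN]]; exists [set x | N (x * t^-1)%g]; split.
- rewrite -[X in measurable X]setTI.
  exact: (borel_homeo (@continuous_mulgr G t^-1%g)).
- by rewrite DE// N0 mule0.
- by move=> x nx; apply: fgN => e; apply: nx; congr (_ * _); exact: e.
Qed.

Lemma L1_trans_pi (f : L1fun mu w) :
  L1_trans (\pi_(L1 mu w)%qT f) = \pi_(L1 mu w)%qT (L1fun_trans f).
Proof. by apply/L1_pi_eq; apply: ae_rtrans; exact: L1_repr. Qed.

Lemma L1_trans_linear : linear L1_trans.
Proof.
move=> k; elim/quotW => f; elim/quotW => g.
have -> : k *: \pi_(L1 mu w)%qT f + \pi_(L1 mu w)%qT g = \pi_(L1 mu w)%qT (k *: f + g).
  by rewrite L1_piD L1_piZ.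
rewrite !L1_trans_pi.
have -> : L1fun_trans (k *: f + g) = k *: L1fun_trans f + L1fun_trans g.
  apply/val_inj/funext => x.
  change ((c%:C)%C * (k * f (x * t^-1)%g + g (x * t^-1)%g) =
    k * ((c%:C)%C * f (x * t^-1)%g) + (c%:C)%C * g (x * t^-1)%g).
  by rewrite mulrDr mulrCA.
by rewrite L1_piD L1_piZ.
Qed.

Lemma L1_trans_norm_le a : `|L1_trans a| <= `|a|.
Proof.
elim/quotW: a => f; rewrite L1_trans_pi.
rewrite [leLHS](L1_norm_pi (L1fun_trans f)) [leRHS](L1_norm_pi f) lecR.
have /wL1P[mf _] := L1funP f.
by apply: fine_le; [exact: L1fun_wnorm..|exact: wnorm_rtrans_le].
Qed.

Lemma L1_trans_norm_ge (K : R) a : 0 < K -> (forall s t, w s * w t <= K * w (s *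
  t)%g) ->
  `|a| <= (K%:C)%C * `|L1_trans a|.
Proof.
move=> K0 wK; elim/quotW: a => f; rewrite L1_trans_pi.
rewrite [leLHS](L1_norm_pi f) [X in _ * X](L1_norm_pi (L1fun_trans f)).
rewrite -rmorphM lecR.
have /wL1P[mf _] := L1funP f.
rewrite -[K]/(fine K%:E) -fineM//; last exact: L1fun_wnorm.
apply: fine_le; [exact: L1fun_wnorm| |exact: wnorm_rtrans_ge].
by rewrite fin_numM//; exact: L1fun_wnorm.
Qed.

(** The identity holds pointwise for convolutions. A convolution and its translate lie in [wL1]
    together or not at all, so [insubd] takes its default 0 on both sides or on neither. *)
Lemma L1_trans_mul (K : R) a b : 0 < K -> (forall s t, w s * w t <= K * w (s * t)%g) ->
  L1_trans (L1_mul a b) = L1_mul a (L1_trans b).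
Proof.
move=> K0 wK; rewrite /L1_mul L1_trans_pi; congr (\pi_(L1 mu w)%qT _).
have /wL1P[mf _] := L1funP (repr a); have /wL1P[mg _] := L1funP (repr b).
have /wL1P[mg' _] := L1funP (repr (L1_trans b)).
have -> : convolution mu (repr a) (repr (L1_trans b)) =
    rtrans c t (convolution mu (repr a) (repr b)).
  (* The representative of [L1_trans b] agrees only almost everywhere with the translate of that of
     [b]. *)
  rewrite -convolution_rtrans//; apply: convolution_ae_eq => //.
  - exact: cmeasurable_rtrans.
  - exact: (L1_repr (L1fun_trans (repr b))).
set h := convolution _ _ _; apply/val_inj.
have [hL|hL] := boolP (h \in wL1 mu w).
  by rewrite /= !insubdK//; exact: wL1_rtrans.
rewrite /= /insubd !insubN//=; last by apply: contra hL; exact: wL1_rtransV wK.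
by apply/funext => x; rewrite /rtrans mulr0.
Qed.

End translation_operator.

(** * Compactly supported functions are dense *)

Section density.
Variables (R : realType) (G : topologicalGroupType).
Variables (mu : {measure set (borel G) -> \bar R}) (w : weight R G).
Hypothesis lcG : locally_compact_group G.
Hypothesis haar_mu : left_haar mu.
Implicit Types (f g : G -> R[i]).

Definition restr (S : set G) f : G -> R[i] := fun x => ((\1_S x)%:C)%C * f x.

Lemma restr_in S f x : S x -> restr S f x = f x.
Proof. by move=> Sx; rewrite /restr indicE mem_set// mul1r. Qed.

Lemma restr_notin S f x : ~ S x -> restr S f x = 0.
Proof. by move=> Sx; rewrite /restr indicE memNset// mul0r. Qed.

Lemma cmeasurable_restr S f : measurable (S : set (borel G)) -> cmeasurable f ->
  cmeasurable (restr S f).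
Proof.
move=> mS mf; apply: cmeasurable_mul => //; split; last exact: measurable_cst.
exact: measurable_indic.
Qed.

Lemma wintegrand_restr S f x :
  wintegrand w (restr S f) x = ((\1_S x)%:E * wintegrand w f x)%E.
Proof.
by rewrite /wintegrand /restr cnorm_realM ?indicE// -EFinM mulrCA.
Qed.

Lemma wL1_restr S f : measurable (S : set (borel G)) -> f \in wL1 mu w ->
  restr S f \in wL1 mu w.
Proof.
move=> mS /wL1P[mf nf]; apply/wL1P; split; first exact: cmeasurable_restr.
apply: le_lt_trans nf; apply: ge0_le_integral => //.
- by move=> x _; exact: wintegrand_ge0.
- by apply: measurable_wintegrand; exact: cmeasurable_restr.
- exact: measurable_wintegrand.
move=> x _; rewrite wintegrand_restr indicE; case: (_ \in _).
  by rewrite mul1e.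
by rewrite mul0e; exact: wintegrand_ge0.
Qed.

(* The tail where w|f| is outside [1/n, n] has small integral by dominated
   convergence; the rest lives on a set of finite measure. *)
Lemma wL1_compact_approx f (e : R) : f \in wL1 mu w -> 0 < e ->
  exists2 C, compact C & (wnorm mu w (restr (~` C) f) <= e%:E)%E.
Proof.
move=> /wL1P[mf nf] e0.
pose phi x : R := w x * cnorm (f x).
have phi0 x : 0 <= phi x by rewrite mulr_ge0 ?cnorm_ge0// ltW// weight_gt0.
have mphi : measurable_fun setT (phi : borel G -> R).
  by have /measurable_EFinP := @measurable_wintegrand R G w f mf.
pose E n : set (borel G) := phi @^-1` `[n.+1%:R^-1, +oo[.
pose B n : set (borel G) := phi @^-1` `[n.+1%:R^-1, n.+1%:R].
have mpre (i : interval R) : measurable (phi @^-1` [set` i] : set (borel G)).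
  by rewrite -[X in measurable X]setTI; exact: mphi.
have mE n : measurable (E n) by exact: mpre.
have mB n : measurable (B n) by exact: mpre.
pose tail n (x : borel G) : \bar R := (phi x * \1_(~` B n) x)%:E.
have mtail n : measurable_fun setT (tail n).
  apply/measurable_EFinP; apply: measurable_funM => //.
  by apply: measurable_indic; exact: measurableC.
have tail0 n x : (0 <= tail n x)%E by rewrite lee_fin mulr_ge0.
have tail_cvg : (\int[mu]_x tail n x @[n --> \oo] --> \int[mu]_x (cst 0 x))%E.
  apply: (@dominated_cvg _ _ _ mu setT measurableT tail (cst 0%E) (EFin \o phi)) => //.
  - move=> x _; apply: cvg_near_cst; have [phix|phix] := eqVneq (phi x) 0.
      by apply: nearW => n; rewrite /tail phix mul0r.
    have phix0 : 0 < phi x by rewrite lt_neqAle eq_sym phix phi0.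
    near=> n; rewrite /tail indicE in_setC mem_set ?mulr0//=; rewrite /B /= in_itv /=.
    apply/andP; split; first by apply/ltW; near: n;
      exact: near_infty_natSinv_lt (PosNum phix0).
    near: n; exists (Num.truncn (phi x)).+1 => // n /= nphi.
    by apply/ltW/(lt_le_trans (truncnS_gt _)); rewrite ler_nat ltnW.
  - apply/integrableP; split; first exact/measurable_EFinP.
    rewrite (eq_integral (wintegrand w f))// => x _.
    by rewrite gee0_abs// lee_fin.
  - move=> n x _; rewrite gee0_abs// lee_fin indicE; case: (_ \in _);
    first by rewrite mulr1.
    by rewrite mulr0.
have [n tn] : exists n, (\int[mu]_x tail n x < (e / 2)%:E)%E.
  have e20 : (0 < (e / 2)%:E)%E by rewrite lte_fin divr_gt0.
  rewrite integral_cst// mul0e in tail_cvg.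
  have := tail_cvg _ (open_ereal_lt' e20).
  by move=> /(@filter_ex _ (\oo : set_system nat)) [n nlt]; exists n.
have n0 : 0 < n.+1%:R^-1 :> R by rewrite invr_gt0.
(* Markov's inequality. *)
have Eoo : (mu (E n) < +oo)%E.
  have mphiE : measurable_fun setT (EFin \o phi : borel G -> \bar R) by
    exact/measurable_EFinP.
  have := le_integral_abse mu measurableT mphiE n0.
  rewrite setTI (_ : [set x | _] = E n); last first.
    apply/seteqP; split=> x /=; rewrite /E /= in_itv/= andbT lee_fin ger0_norm//.
  rewrite (eq_integral (wintegrand w f)); last by move=> x _;
    rewrite gee0_abs// lee_fin.
  by move=> /le_lt_trans/(_ nf); rewrite lte_pdivrMl// => /lt_le_trans; apply;
    rewrite leey.
have [U [oU EU] Uoo] : exists2 U, open U /\ E n `<=` U & (mu U < +oo)%E.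
  move: Eoo; rewrite (haar_outer haar_mu (mE n)) => /ereal_inf_lt[_ [U UE <-] Uoo].
  by exists U.
have mU := borel_open oU.
(* On [B n] the integrand is at most [n.+1], so a set of this measure contributes at most
   [e / 2]. *)
have d0 : 0 < e / 2 / n.+1%:R by rewrite !divr_gt0.
have [C [cC CU UC]] := haar_inner_approx lcG haar_mu oU Uoo d0.
exists C => //.
have mC := borel_compact lcG cC.
have mUC : measurable (U `\` C : set (borel G)) by exact: measurableD.
(* Off [C], a point outside [B n] is handled by [tail n]; a point of [B n] lies in [E n], hence in
   [U] without [C]. *)
apply: (@le_trans _ _ (\int[mu]_x (tail n x + (n.+1%:R * \1_(U `\` C) x)%:E))%E).
  apply: ge0_le_integral => //.
  - by move=> x _; exact: wintegrand_ge0.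
  - by apply: measurable_wintegrand; apply: cmeasurable_restr => //; exact: measurableC.
  - apply: emeasurable_funD => //; apply/measurable_EFinP.
    by apply: measurable_funM; [exact: measurable_cst|exact: measurable_indic].
  move=> x _; rewrite wintegrand_restr -EFinM -EFinD lee_fin -/(phi x) mulrC.
  rewrite !indicE !in_setC in_setD.
  have [xC|xC] /= := boolP (x \in C); first by rewrite mulr0 addr_ge0// mulr_ge0.
  rewrite mulr1 andbT; have [xB|xB] /= := boolP (x \in B n); last first.
    by rewrite mulr1 lerDl mulr_ge0.
  move: xB; rewrite inE /B /= in_itv /= => /andP[xE xn].
  by rewrite mem_set ?mulr1 ?mulr0 ?add0r//; apply: EU; rewrite /E /= in_itv /= xE.
rewrite ge0_integralD//; last first.
  by apply/measurable_EFinP; apply: measurable_funM;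
    [exact: measurable_cst|exact: measurable_indic].
rewrite [e in leRHS](splitr e) EFinD leeD//; first exact: ltW.
under eq_integral do rewrite EFinM.
rewrite ge0_integralZl_EFin//; last by apply/measurable_EFinP; exact: measurable_indic.
by rewrite integral_indic// setIT -lee_pdivlMl// -EFinM mulrC.
Unshelve. all: by end_near. Qed.
End density.

(** * Disjoint translates *)

Section covering.
Local Open Scope card_scope.

Lemma exists_disjoint_translates (G : topologicalGroupType) (d : Order.disp_t)
    (I : orderType d) :
  locally_compact_group G -> ~ compact [set: G] -> initial_ordinal I ->
  compact_covering_number G I ->
  exists (K : I -> set G) (t : I -> G), [/\ forall i, compact (K i),
    forall x : G, exists i, nbhs x (K i) &
    forall i j g h x y, (j < i)%O -> (g <= i)%O -> (h <= j)%O -> K g x -> K h y ->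
      (x * t i)%g <> (y * t j)%g].
Proof.
move=> lcG ncG [wfI initI] [[F [cF FG] FI] minI].
have FleI : F #<= [set: I] by case/card_eqPle: FI.
(* A finite index set would make [G] a finite union of compact sets. *)
have infI : infinite_set [set: I].
  move=> finI; apply: ncG; rewrite -FG.
  have /finite_seqP[X XF] := card_le_finite FleI finI.
  rewrite XF bigcup_seq; rewrite big_seq; apply: bigsetU_compact => C CX.
  by apply: cF; rewrite XF.
have [i0 _] := infinite_setN0 infI.
have [b _ binj] := card_le_set_fun i0 FleI.
have [V cV nV] := compact_nbhs1 lcG.
(* The covering is reindexed by [I] through the injection [b], with the empty set at indices not
   attained. *)
pose K0 i : set G := if pselect (exists2 C, F C & b C = i) is left e then
  projT1 (cid2 e) else set0.
have cK0 i : compact (K0 i).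
  rewrite /K0; case: pselect => [e|_]; last exact: compact0.
  by case: (cid2 e) => C FC _ /=; exact: cF.
have K0b C : F C -> K0 (b C) = C.
  move=> FC; rewrite /K0; case: pselect => [e|[]]; last by exists C.
  by case: (cid2 e) => C' FC' bC' /=; apply: binj => //; rewrite inE.
(* Thickening by the compact neighborhood [V] of 1 makes every point interior to some [K i]. *)
pose K i := [set x * v | x in K0 i & v in V]%g.
have cK i : compact (K i) by exact: compact_mulg.
have nK (x : G) : exists i, nbhs x (K i).
  have [C FC Cx] : (\bigcup_(C in F) C) x by rewrite FG.
  exists (b C); apply: near1_mul; apply: filterS nV => v Vv.
  by exists x; [rewrite K0b|exists v].
pose P i (t : I -> G) y := forall j g h x z, (j < i)%O -> (g <= i)%O -> (h <= j)%O ->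
  K g x -> K h z -> (x * y)%g <> (z * t j)%g.
have [i t t' tt'|i t|t tP] := @wf_dependent_choice I G (fun x y => (x < y)%O) 1%g P wfI.
- apply/funext => y; apply/propext; split=> Py j g h x z ji gi hj Kx Kz;
    have := Py j g h x z ji gi hj Kx Kz; rewrite tt'//.
- apply: contrapT => noy.
  pose S := [set j : I | (j <= i)%O].
  (* The value of [Fam] at [(g, (h, j))] is $K_g^{-1} K_h t_j$. If no [y] were admissible, these
     compact sets would cover [G], and minimality of the covering number would contradict
     [card_segment_cube]. *)
  pose Fam (p : I * (I * I)) := [set x * z | x in [set a^-1 | a in K p.1] & z in
    [set z * z' | z in K p.2.1 & z' in [set t p.2.2]]]%g.
  apply: (@card_segment_cube _ I wfI i infI initI).
  apply: card_le_trans (card_image_le Fam (S `*` (S `*` S))); apply: minI.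
  split=> [_ [p _ <-]|].
    apply: compact_mulg; first exact: compact_invg.
    by apply: compact_mulg => //; exact: compact_set1.
  apply/seteqP; split=> // y _; apply: contrapT => ny; apply: noy.
  exists y => j g h x z ji gi hj Kx Kz xy; apply: ny.
  have Sj : (j <= i)%O by exact: ltW.
  exists (Fam (g, (h, j))); first by exists (g, (h, j)) => //; split=> //;
    split=> //=; exact: le_trans hj Sj.
  exists x^-1%g; first by exists x.
  exists (z * t j)%g; first by exists z => //; exists (t j).
  by rewrite -xy mulKg.
exists K, t; split=> // i j g h x y ji gi hj Kx Ky; exact: (tP i j g h x y).
Qed.

End covering.

(** * Linear spans *)

Section linear_span.
Variables (K : numFieldType) (A : normedModType K).
Implicit Types (E P : set A) (x y : A).

Lemma lin_span_min E P : P 0 -> (forall x y, P x -> P y -> P (x + y)) ->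
  (forall c x, P x -> P (c *: x)) -> E `<=` P -> lin_span E `<=` P.
Proof.
move=> P0 PD PZ EP _ [n [c [v [Ev ->]]]].
by elim/big_ind : _ => // i _; exact/PZ/EP.
Qed.

Lemma lin_span0 E : lin_span E 0.
Proof.
by exists 0%N, (fun=> 0), (fun=> 0); split=> [[]//|]; rewrite big_ord0.
Qed.

Lemma lin_span_scale E c x : E x -> lin_span E (c *: x).
Proof. by move=> Ex; exists 1%N, (fun=> c), (fun=> x); rewrite big_ord1. Qed.

Lemma lin_spanD E x y : lin_span E x -> lin_span E y -> lin_span E (x + y).
Proof.
move=> [n [c [v [Ev ->]]]] [m [c' [v' [Ev' ->]]]].
exists (n + m)%N, (fun i : 'I_(n + m) => match fintype.split i with inl j =>
  c j | inr j => c' j end),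
  (fun i : 'I_(n + m) => match fintype.split i with inl j => v j | inr j =>
    v' j end); split.
  by move=> i; case: (fintype.split i).
rewrite big_split_ord /=; congr (_ + _); apply: eq_bigr => i _.
  by rewrite (unsplitK (inl i)).
by rewrite (unsplitK (inr i)).
Qed.

End linear_span.

(** * Disjoint supports and additivity of the norm *)

Section supports.
Variables (R : realType) (G : topologicalGroupType).
Variables (mu : {measure set (borel G) -> \bar R}) (w : weight R G).

(** The representative vanishes everywhere off [S], not just almost everywhere, so disjointness can
    be used pointwise. *)
Definition L1_supported (S : set G) : set (L1 mu w) :=
  [set a | exists f : L1fun mu w, a = \pi_(L1 mu w)%qT f /\ forall x, f x != 0 -> S x].

Lemma lin_span_L1_supported (E : set (L1 mu w)) (S : set G) :
  E `<=` L1_supported S -> lin_span E `<=` L1_supported S.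
Proof.
apply: lin_span_min.
- exists 0; split=> // x; by rewrite eqxx.
- move=> _ _ [f [-> fS]] [g [-> gS]]; exists (f + g); split; first by rewrite L1_piD.
  move=> x; rewrite L1fun_valD; have [->|/fS//] := eqVneq (f x) 0.
  by rewrite add0r => /gS.
- move=> c _ [f [-> fS]]; exists (c *: f); split; first by rewrite L1_piZ.
  by move=> x; rewrite L1fun_valZ mulf_eq0 negb_or => /andP[_ /fS].
Qed.

Lemma L1_supported_disjoint (S S' : set G) a : S `&` S' = set0 ->
  L1_supported S a -> L1_supported S' a -> a = 0.
Proof.
move=> SS' [f [-> fS]] [g [/L1_pi_eq fg gS']]; apply/L1_pi_eq.
apply: filterS fg => x fgx; apply/eqP; apply: contraT => fx.
suff : (S `&` S') x by rewrite SS'.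
by split; [exact: fS|apply: gS'; rewrite -fgx].
Qed.

(** At each point at most one summand is nonzero, so the modulus of the sum is the sum of the
    moduli. *)
Lemma wnorm_sum_disjoint (p : nat) (S : 'I_p -> set G) (f : 'I_p -> L1fun mu w) :
  (forall i j, i <> j -> S i `&` S j = set0) -> (forall i x, f i x != 0 -> S i x) ->
  (wnorm mu w (\sum_(i < p) f i)%R = \sum_(i < p) wnorm mu w (f i))%E.
Proof.
move=> Sdisj fS; have mf i : cmeasurable (f i) by have /wL1P[] := L1funP (f i).
rewrite /wnorm -ge0_integral_sum//; last 2 first.
- by move=> i; exact: measurable_wintegrand.
- by move=> i x _; exact: wintegrand_ge0.
apply: eq_integral => x _; rewrite /wintegrand sumEFin -mulr_sumr; congr (_ * _)%:E.
have -> : (\sum_(i < p) f i : L1fun mu w) x = \sum_(i < p) f i x.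
  by elim/big_rec2 : _ => // i _ h _ <-; rewrite L1fun_valD.
have [[i fi]|nf] := pselect (exists i, f i x != 0).
  have fj j : j != i -> f j x = 0.
    move=> /eqP ji; apply/eqP; apply: contraT => /fS Sj.
    suff : (S j `&` S i) x by rewrite Sdisj.
    by split=> //; exact: fS.
  rewrite (bigD1 i)//= big1 ?addr0//.
  by rewrite (bigD1 i)//= big1 ?addr0// => j /fj ->; rewrite ComplexField.Normc.normc0.
have f0 i : f i x = 0 by apply/eqP; apply: contraT => fi; case: nf; exists i.
rewrite big1// big1 ?ComplexField.Normc.normc0// => i _.
by rewrite f0 ComplexField.Normc.normc0.
Qed.

Lemma L1_norm_sum_disjoint (p : nat) (S : 'I_p -> set G) (a : 'I_p -> L1 mu w) :
  (forall i j, i <> j -> S i `&` S j = set0) -> (forall i, L1_supported (S i) (a i)) ->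
  \sum_(i < p) `|a i| = `|\sum_(i < p) a i|.
Proof.
move=> Sdisj aS; have [f fP] := choice aS.
have aE i : a i = \pi_(L1 mu w)%qT (f i) by case: (fP i).
have -> : \sum_(i < p) a i = \pi_(L1 mu w)%qT (\sum_(i < p) f i).
  by elim/big_rec2 : _ => // i b g _ ->; rewrite aE L1_piD.
rewrite [RHS]L1_norm_pi (wnorm_sum_disjoint Sdisj); last by move=> i; case: (fP i).
rewrite -sum_fine; last by move=> i _; exact: L1fun_wnorm.
rewrite rmorph_sum /=; apply: eq_bigr => i _; rewrite aE; exact: L1_norm_pi.
Qed.

End supports.

(** * Density of the span of functions with small support *)

Section small_supports.
Variables (R : realType) (G : topologicalGroupType).
Variables (mu : {measure set (borel G) -> \bar R}) (w : weight R G).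
Hypothesis lcG : locally_compact_group G.
Hypothesis haar_mu : left_haar mu.
Variables (J : choiceType) (K : J -> set G).
Hypothesis cK : forall j, compact (K j).
Hypothesis nK : forall x : G, exists j, nbhs x (K j).

Definition L1fun_restr (S : set G) (mS : measurable (S : set (borel G)))
  (f : L1fun mu w) : L1fun mu w := L1Fun (wL1_restr mS (L1funP f)).

Lemma L1fun_restrD (S : set G) (mS : measurable (S : set (borel G))) (f : L1fun mu w) :
  f = L1fun_restr mS f + L1fun_restr (measurableC mS) f.
Proof.
apply/val_inj/funext => x.
change (f x = restr S f x + restr (~` S) f x).
have [Sx|nSx] := pselect (S x).
  by rewrite restr_in// restr_notin ?addr0//; exact: contrapT.
by rewrite restr_notin// restr_in// add0r.
Qed.

Lemma L1fun_restr_neq0 (S : set G) (mS : measurable (S : set (borel G)))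
  (f : L1fun mu w) x : L1fun_restr mS f x != 0 -> S x /\ f x != 0.
Proof.
change (restr S f x != 0 -> S x /\ f x != 0).
have [Sx|nSx] := pselect (S x); first by rewrite restr_in.
by rewrite restr_notin// eqxx.
Qed.

(** The union of the sets [As i] of the final proof. *)
Let E : set (L1 mu w) := [set a | `|a| <= 1 /\ exists j, L1_supported (K j) a].

(** The part of [f] on [K j] is split off and rescaled into the unit ball; the remainder is
    supported in the other sets of the list. *)
Lemma lin_span_finite_support (s : seq J) (f : L1fun mu w) :
  (forall x, f x != 0 -> exists2 j, j \in s & K j x) ->
  lin_span E (\pi_(L1 mu w)%qT f).
Proof.
elim: s f => [|j s IH] f fs.
  rewrite (_ : f = 0); first exact: lin_span0.
  apply/val_inj/funext => x; apply/eqP; apply: contraT => /fs[k].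
  by rewrite in_nil.
have mKj := borel_compact lcG (@cK j).
rewrite (L1fun_restrD mKj f) L1_piD; apply: lin_spanD; last first.
  apply: IH => x /L1fun_restr_neq0[nKx /fs[k]].
  by rewrite inE => /orP[/eqP->//|ks Kx]; exists k.
set a := \pi_(L1 mu w)%qT _.
(* The scaling factor exceeds the norm of [a] and is nonzero even for [a = 0]. *)
have N0 : 0 < 1 + `|a| by rewrite ltr_pwDl.
have -> : a = (1 + `|a|) *: ((1 + `|a|)^-1 *: a).
  by rewrite scalerA mulfV ?scale1r// gt_eqF.
apply: lin_span_scale; split.
  rewrite normrZ normfV gtr0_norm// ler_pdivrMl// mulr1.
  by rewrite lerDr.
exists j, ((1 + `|a|)^-1 *: L1fun_restr mKj f); split; first by rewrite L1_piZ.
by move=> x; rewrite L1fun_valZ mulf_eq0 negb_or => /andP[_ /L1fun_restr_neq0[]].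
Qed.

Lemma closure_small_supports : closure (lin_span E) = setT.
Proof.
apply/seteqP; split=> // a _ B /nbhs_ballP[e /= e0 eB].
elim/quotW: a eB => f eB.
(* The radius is a complex number; being positive, it is real. *)
have eE : e = ((complex.Re e)%:C)%C.
  by move: e0; case: e {eB} => x y; rewrite ltcE /= => /andP[/eqP-> _].
have e0' : 0 < complex.Re e by move: e0; rewrite eE ltcR.
have e20 : 0 < complex.Re e / 2 by rewrite divr_gt0.
have [C cC Cf] := wL1_compact_approx lcG haar_mu (L1funP f) e20.
have mC := borel_compact lcG cC.
have [s Cs] : exists s : seq J, C `<=` \bigcup_(j in [set` s]) (K j)°.
  apply: compact_open_cover => // [j|x _]; first exact: open_interior.
  by have [j] := nK x; exists j.
exists (\pi_(L1 mu w)%qT (L1fun_restr mC f)); split.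
  apply: (@lin_span_finite_support s) => x /L1fun_restr_neq0[/Cs[j js Kx] _].
  by exists j => //; exact: interior_subset Kx.
apply: eB; rewrite -ball_normE /ball_ /=.
rewrite {1}(L1fun_restrD mC f) L1_piD addrC addKr.
rewrite [ltLHS]L1_norm_pi eE ltcR.
apply: (@le_lt_trans _ _ (complex.Re e / 2)); last first.
  by rewrite ltr_pdivrMr// ltr_pMr// ltr1n.
rewrite -lee_fin fineK; last exact: L1fun_wnorm.
exact: Cf.
Qed.

End small_supports.

(** * The base formed by disjointly supported translates *)

Theorem theorem7p1 (R : realType) (G : topologicalGroupType)
    (mu : {measure set (borel G) -> \bar R}) (w : weight R G)
    (d : Order.disp_t) (I : orderType d)
    (lcG : locally_compact_group G)
    (ncG : ~ compact [set: G])
    (haar_mu : left_haar mu)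
    (ordI : initial_ordinal I)
    (covI : compact_covering_number G I)
    (dbw : diagonally_bounded w) :
  exists L : set (L1 mu w), Fl1_base_type2 (@L1_mul R G mu w) I L.
Proof.
have [k k0 wk] := dbw.
have [K [t [cK nK Kt]]] := exists_disjoint_translates lcG ncG ordI covI.
have [D DP] := choice (fun i => haar_modular lcG haar_mu (t i)).
pose T i := L1_trans (w := w) (proj1 (DP i)) (proj2 (DP i)).
pose As i : set (L1 mu w) := [set a | `|a| <= 1 /\
  exists2 g, (g <= i)%O & L1_supported (K g) a].
(* This is the union of the $K_g t_i$ with $g \le i$, where every translate of an element of [As i]
   lives. *)
pose S i : set G := [set x | exists2 g, (g <= i)%O & K g (x * (t i)^-1)%g].
have Sdisj i j : i <> j -> S i `&` S j = set0.
  have H i' j' x : (j' < i')%O -> S i' x -> S j' x -> False.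
    move=> ji [g gi Kg] [h hj Kh].
    by apply: (Kt i' j' g h _ _ ji gi hj Kg Kh); rewrite !mulgVK.
  move=> ij; apply/seteqP; split=> // x [Si Sj].
  by case: (ltgtP i j) ij => [/H|/H|//] F _; [exact: F Sj Si|exact: F Si Sj].
have spanS i : lin_span (T i @` As i) `<=` L1_supported (S i).
  apply: lin_span_L1_supported => _ [a [_ [g gi [f [-> fK]]]] <-].
  exists (L1fun_trans (proj1 (DP i)) (proj2 (DP i)) f); split; first exact: L1_trans_pi.
  by move=> x; rewrite mulf_eq0 negb_or => /andP[_ /fK Kx]; exists g.
exists (\bigcup_i (T i @` As i)), As, T; split=> //.
- split=> [i j ij a [a1 [g gi ag]]|a [i _ []]//|].
    by split=> //; exists g => //; exact: le_trans gi ij.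
  rewrite (_ : \bigcup_i As i = [set a | `|a| <= 1 /\ exists j, L1_supported (K j) a]).
    exact: closure_small_supports.
  apply/seteqP; split=> [a [i _ [a1 [g _ ag]]]|a [a1 [j aj]]].
    by split=> //; exists g.
  by exists j => //; split=> //; exists j.
- split=> [i|]; last first.
    by exists 1 => i a; rewrite mul1r; exact: L1_trans_norm_le.
  split; first exact: L1_trans_linear.
    by exists 1 => a; rewrite mul1r; exact: L1_trans_norm_le.
  by move=> a b; exact: L1_trans_mul k0 wk.
- move=> i j ij; apply/seteqP; split=> [a [/spanS ai /spanS aj]|_ ->].
    exact: L1_supported_disjoint (Sdisj _ _ ij) ai aj.
  by split; exact: lin_span0.
- split.
    (* Norms of disjointly supported elements add up exactly, so $K_1 = 1$. *)
    exists 1 => // p al x inj_al xS; rewrite mul1r.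
    rewrite (@L1_norm_sum_disjoint _ _ _ _ p (S \o al))// => [i j ij|i].
      by apply: Sdisj => /inj_al.
    exact: spanS (xS i).
  (* $K_2$ is the constant of diagonal boundedness. *)
  exists (k%:C)%C; first by rewrite ltcR.
  by move=> i a _; exact: L1_trans_norm_ge k0 wk.
Qed.
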